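(* Let $n\ge 3$ and $\eta\in\mathbb R$, and let $T^*V_{n,2}$ be equipped with the twisted symplectic form $\omega_\eta$. Let $ds^2_{sR,a}$ be one of the $SO(n)$-invariant sub-Riemannian structures $ds^2_{\mathcal H,a}$ or $ds^2_{\mathcal D_0,a}$ on $V_{n,2}$ (for $n=3$ only $ds^2_{\mathcal H,a}$ is considered), with Hamiltonian $H_{sR,a}$ equal to $H_{\mathcal H,a}$ or $H_{\mathcal D_0,a}$ respectively. Then the magnetic sub-Riemannian geodesic flow of $ds^2_{sR,a}$, i.e. the Hamiltonian flow of $H_{sR,a}$ on $(T^*V_{n,2},\omega_\eta)$, is completely integrable in the non-commutative sense. The complete algebra of first integrals is generated by the components of the momentum mapping $$\Phi_\eta^{ij}=\langle \Phi_\eta,\mathbf E_i\wedge \mathbf E_j\rangle,\qquad 1\le i<j\le n,$$ and the Hamiltonian function $H_{sR,a}$. For $n\ge 4$ the dimension of the invariant tori is equal to $3$. For $n=3$ the dimension of the invariant tori is equal to $2$.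
   Context: **Stiefel variety and cotangent bundle.** $V_{n,2}=\{(\mathbf e_1,\mathbf e_2)\in\mathbb R^{n}\times\mathbb R^n : \langle \mathbf e_1,\mathbf e_1\rangle=\langle \mathbf e_2,\mathbf e_2\rangle=1,\ \langle \mathbf e_1,\mathbf e_2\rangle=0\}\cong SO(n)/SO(n-2)$. Its cotangent bundle is realized as the set of $(\mathbf e_1,\mathbf e_2,\mathbf p_1,\mathbf p_2)\in\mathbb R^{4n}$ with $(\mathbf e_1,\mathbf e_2)\in V_{n,2}$ and $\langle \mathbf e_1,\mathbf p_1\rangle=0$, $\langle \mathbf e_2,\mathbf p_2\rangle=0$, $\langle \mathbf e_1,\mathbf p_2\rangle+\langle \mathbf e_2,\mathbf p_1\rangle=0$; thus $\dim T^*V_{n,2}=4n-6$. The standard contact form is $\alpha=-\sum_i e_2^i\,de_1^i|_{V_{n,2}}$. **Twisted symplectic form.** $\omega_\eta$ is the restriction to $T^*V_{n,2}$ of $\sum_i \big(dp_1^i\wedge de_1^i+dp_2^i\wedge de_2^i\big)+\eta\sum_i de_1^i\wedge de_2^i$, i.e. the canonical form plus $\eta$ times the pull-back of $d\alpha$. The sign convention is that for $\eta=0$ in $\mathbb R^{4n}$ Hamilton's equations read $\dot{\mathbf e}_i=\partial H/\partial \mathbf p_i$, $\dot{\mathbf p}_i=-\partial H/\partial \mathbf e_i$. **Momentum mapping.** For $x,y\in\mathbb R^n$ (columns), $x\wedge y=xy^T-yx^T\in so(n)$; $\langle A,B\rangle=-\frac12\operatorname{tr}(AB)$ on $so(n)$;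 $\mathbf E_1,\dots,\mathbf E_n$ is the standard basis of $\mathbb R^n$. $\Phi_\eta=\mathbf p_1\wedge \mathbf e_1+\mathbf p_2\wedge \mathbf e_2+\eta\,\mathbf e_1\wedge \mathbf e_2$ is the momentum mapping of the left $SO(n)$-action $(\mathbf e_i,\mathbf p_i)\mapsto(R\mathbf e_i,R\mathbf p_i)$ on $(T^*V_{n,2},\omega_\eta)$. **Distributions.** $\mathcal H=\ker\alpha$ is the contact distribution: $\mathcal H|_{(\mathbf e_1,\mathbf e_2)}$ consists of the pairs $(\xi_1,\xi_2)$ with $\xi_1,\xi_2\in\operatorname{span}\{\mathbf e_1,\mathbf e_2\}^\perp$. $\mathcal D_0|_{(\mathbf e_1,\mathbf e_2)}$ is spanned by $Z=(-\mathbf e_2,\mathbf e_1)$ and the vectors $(\xi,0)$ with $\xi\in\operatorname{span}\{\mathbf e_1,\mathbf e_2\}^\perp$. **Sub-Riemannian structures.** $ds^2_{\mathcal H,a}$ is the $SO(n)$-invariant sub-Riemannian structure on $\mathcal H$ whose (normal) geodesic Hamiltonian is $$H_{\mathcal H,a}=\tfrac12 a_1\langle \mathbf p_1,\mathbf p_1\rangle+\tfrac12 a_2\langle \mathbf p_2,\mathbf p_2\rangle+\tfrac12(a_1+a_2)\langle \mathbf p_1,\mathbf e_2\rangle\langle \mathbf p_2,\mathbf e_1\rangle+a_4\langle \mathbf p_1,\mathbf p_2\rangle,\quad a_1>0,\ a_2>0,\ a_1a_2>a_4^2 .$$ $ds^2_{\mathcal D_0,a}$ is the $SO(n)$-invariant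 sub-Riemannian structure on $\mathcal D_0$ whose (normal) geodesic Hamiltonian is $$H_{\mathcal D_0,a}=\tfrac12 a_1\langle \mathbf p_1,\mathbf p_1\rangle+a_3\langle \mathbf p_1,\mathbf e_2\rangle\langle \mathbf p_2,\mathbf e_1\rangle,\quad a_1>0,\ a_1>2a_3 .$$ **Non-commutative integrability.** An algebra $\mathcal F$ of functions (closed under the Poisson bracket) on a symplectic manifold $M$ is complete if at a generic point $x$, with $F_x=\operatorname{span}\{df(x): f\in\mathcal F\}$, one has $\dim F_x+\dim\ker(\{\cdot,\cdot\}|_{F_x})=\dim M$. A Hamiltonian system is completely integrable in the non-commutative sense if it possesses a complete algebra $\mathcal F$ of first integrals. The regular compact connected common level sets of $\mathcal F$ are then isotropic invariant tori of dimension $\dim M-\dim F_x$; this is the ''dimension of invariant tori''. *)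

(* Defs.v *)
From HB Require Import structures.
From mathcomp Require Import all_boot all_order all_algebra.
From mathcomp Require Import all_classical all_reals all_analysis.
From mathcomp Require Import ring lra.
Set Implicit Arguments.
Unset Strict Implicit.
Unset Printing Implicit Defensive.
Import Order.TTheory GRing.Theory Num.Theory numFieldNormedType.Exports.
Local Open Scope classical_set_scope.
Local Open Scope ring_scope.

(* A point of R^2n or R^4n is the matrix whose columns are its n-vectors:
   (e1, e2), respectively (e1, e2, p1, p2).  SO(n) acts by left
   multiplication. *)
Notation config R n := 'M[R]_(n, 2).
Notation phase R n := 'M[R]_(n, 2 + 2).

Definition dot (R : realType) (n : nat) (u v : 'cV[R]_n) : R :=
  (u^T *m v) 0 0.

Definition c1 (R : realType) (n : nat) (q : config R n) : 'cV[R]_n := col 0 q.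
Definition c2 (R : realType) (n : nat) (q : config R n) : 'cV[R]_n := col 1 q.

Definition base (R : realType) (n : nat) (x : phase R n) : config R n :=
  lsubmx x.
Definition momentum (R : realType) (n : nat) (x : phase R n) : config R n :=
  rsubmx x.

Definition e1 (R : realType) (n : nat) (x : phase R n) := c1 (base x).
Definition e2 (R : realType) (n : nat) (x : phase R n) := c2 (base x).
Definition p1 (R : realType) (n : nat) (x : phase R n) := c1 (momentum x).
Definition p2 (R : realType) (n : nat) (x : phase R n) := c2 (momentum x).

Definition stiefel (R : realType) (n : nat) : set (config R n) :=
  [set q | [/\ dot (c1 q) (c1 q) = 1, dot (c2 q) (c2 q) = 1
             & dot (c1 q) (c2 q) = 0]].

Definition cotangent_bundle (R : realType) (n : nat) : set (phase R n) :=
  [set x | [/\ stiefel (base x), dot (e1 x) (p1 x) = 0, dot (e2 x) (p2 x) = 0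
             & dot (e1 x) (p2 x) + dot (e2 x) (p1 x) = 0]].

Definition constraints (R : realType) (n : nat) : seq (phase R n -> R) :=
  [:: (fun x => dot (e1 x) (e1 x)); (fun x => dot (e2 x) (e2 x));
      (fun x => dot (e1 x) (e2 x)); (fun x => dot (e1 x) (p1 x));
      (fun x => dot (e2 x) (p2 x));
      (fun x => dot (e1 x) (p2 x) + dot (e2 x) (p1 x))].

(* The cotangent bundle is a regular level set of the six constraints, so its
   tangent space is the common kernel of their differentials. *)
Definition tangent (R : realType) (n : nat) (x : phase R n) :
    {vspace phase R n} :=
  (\bigcap_(c <- constraints R n)
     lker (linfun ('d c x : phase R n -> R^o)))%VS.

Definition cotangent (R : realType) (n : nat) (x : phase R n) : vectType R :=
  'Hom(subvs_of (tangent x), R^o).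

(* Since the cotangent bundle is a closed submanifold, smooth functions on it
   are the restrictions of smooth functions on R^4n; functions on it are
   represented here by such extensions. *)
Fixpoint iter_derive (R : realType) (n : nat) (vs : seq (phase R n))
    (f : phase R n -> R) : phase R n -> R :=
  if vs is v :: vs' then iter_derive vs' ('D_v f) else f.

Definition smooth (R : realType) (n : nat) : set (phase R n -> R) :=
  [set f | forall vs x, differentiable (iter_derive vs f) x].

Definition dfun (R : realType) (n : nat) (f : phase R n -> R)
    (x : phase R n) : cotangent x :=
  linfun (fun v : subvs_of (tangent x) => 'd f x (vsval v) : R^o).

(* Constant-coefficient form on R^4n, with
   (dp ^ de)(u, v) = dp(u) de(v) - dp(v) de(u). *)
Definition omega (R : realType) (n : nat) (eta : R) (u v : phase R n) : R :=
  (dot (p1 u) (e1 v) - dot (p1 v) (e1 u))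
  + (dot (p2 u) (e2 v) - dot (p2 v) (e2 u))
  + eta * (dot (e1 u) (e2 v) - dot (e1 v) (e2 u)).

Definition flat (R : realType) (n : nat) (eta : R) (x : phase R n) :
    'Hom(subvs_of (tangent x), cotangent x) :=
  linfun (fun u : subvs_of (tangent x) =>
    linfun (fun v : subvs_of (tangent x) =>
      omega eta (vsval u) (vsval v) : R^o) : cotangent x).

(* The tangent vector X with omega(X, .) = - a.  With this sign and eta = 0,
   Hamilton's equations in R^4n read e' = dH/dp, p' = - dH/de. *)
Definition ham_vector (R : realType) (n : nat) (eta : R) (x : phase R n)
    (a : cotangent x) : subvs_of (tangent x) :=
  - (flat eta x)^-1%VF a.

Definition poisson (R : realType) (n : nat) (eta : R) (x : phase R n)
    (a b : cotangent x) : R :=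
  a (ham_vector eta b).

Definition bracket (R : realType) (n : nat) (eta : R)
    (f g : phase R n -> R) (x : phase R n) : R :=
  poisson eta (dfun f x) (dfun g x).

Definition trajectory (R : realType) (n : nat) (eta : R) (H : phase R n -> R)
    (a b : R) (c : R -> phase R n) : Prop :=
  forall t, a < t < b -> cotangent_bundle (c t) /\
    is_derive t (1 : R) c (vsval (ham_vector eta (dfun H (c t)))).

Definition first_integral (R : realType) (n : nat) (eta : R)
    (H f : phase R n -> R) : Prop :=
  forall a b c, trajectory eta H a b c ->
    forall s t, a < s < b -> a < t < b -> f (c s) = f (c t).

Definition function_algebra (R : realType) (n : nat)
    (F : set (phase R n -> R)) : Prop :=
  [/\ forall k : R, F (fun=> k),
      forall f g, F f -> F g -> F (fun x => f x + g x)
    & forall f g, F f -> F g -> F (fun x => f x * g x)].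

Definition generated_algebra (R : realType) (n : nat)
    (S : set (phase R n -> R)) : set (phase R n -> R) :=
  smallest (@function_algebra R n) S.

Definition generic (R : realType) (n : nat) (P : set (phase R n)) : Prop :=
  exists O : set (phase R n),
    [/\ open O, @cotangent_bundle R n `<=` closure (O `&` @cotangent_bundle R n)
      & O `&` @cotangent_bundle R n `<=` P].

Definition is_span (R : realType) (V : vectType R) (S : set V)
    (U : {vspace V}) : Prop :=
  (forall v, S v -> v \in U) /\
  (forall W : {vspace V}, (forall v, S v -> v \in W) -> (U <= W)%VS).

Definition span_set (R : realType) (V : vectType R) (S : set V) : {vspace V} :=
  xget 0%VS (is_span S).

Definition differentials (R : realType) (n : nat) (F : set (phase R n -> R))
    (x : phase R n) : {vspace cotangent x} :=
  span_set [set dfun f x | f in F].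

Definition poisson_kernel (R : realType) (n : nat) (eta : R) (x : phase R n)
    (U : {vspace cotangent x}) : {vspace cotangent x} :=
  span_set [set a | a \in U /\ forall b, b \in U -> poisson eta a b = 0].

Definition complete_algebra (R : realType) (n : nat) (eta : R)
    (F : set (phase R n -> R)) : Prop :=
  [/\ F `<=` @smooth R n,
      function_algebra F,
      forall f g, F f -> F g -> exists2 h, F h &
        forall x, cotangent_bundle x -> h x = bracket eta f g x
    & generic [set x | (\dim (differentials F x) +
                          \dim (poisson_kernel eta (differentials F x)))%N
                       = \dim (tangent x)]].

Definition nc_integrable (R : realType) (n : nat) (eta : R)
    (H : phase R n -> R) : Prop :=
  exists F, complete_algebra eta F /\
    forall f, F f -> first_integral eta H f.

(* Additive form of d = dim M - dim F_x at a generic point. *)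
Definition invariant_tori_dim (R : realType) (n : nat)
    (F : set (phase R n -> R)) (d : nat) : Prop :=
  generic [set x | (\dim (differentials F x) + d)%N = \dim (tangent x)].

Definition wedge (R : realType) (n : nat) (x y : 'cV[R]_n) : 'M[R]_n :=
  x *m y^T - y *m x^T.

Definition so_dot (R : realType) (n : nat) (A B : 'M[R]_n) : R :=
  - (1 / 2) * \tr (A *m B).

Definition std_basis (R : realType) (n : nat) (i : 'I_n) : 'cV[R]_n :=
  delta_mx i 0.

Definition Phi (R : realType) (n : nat) (eta : R) (x : phase R n) : 'M[R]_n :=
  wedge (p1 x) (e1 x) + wedge (p2 x) (e2 x) + eta *: wedge (e1 x) (e2 x).

Definition Phi_coord (R : realType) (n : nat) (eta : R) (i j : 'I_n)
    (x : phase R n) : R :=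
  so_dot (Phi eta x) (wedge (std_basis R i) (std_basis R j)).

Definition integral_generators (R : realType) (n : nat) (eta : R)
    (H : phase R n -> R) : set (phase R n -> R) :=
  [set f | (exists i j : 'I_n, (i < j)%N /\ f = Phi_coord eta i j) \/ f = H].

Definition contact_distribution (R : realType) (n : nat) (q : config R n) :
    set (config R n) :=
  [set v | [/\ dot (c1 q) (c1 v) = 0, dot (c2 q) (c1 v) = 0,
               dot (c1 q) (c2 v) = 0 & dot (c2 q) (c2 v) = 0]].

Definition D0_distribution (R : realType) (n : nat) (q : config R n) :
    set (config R n) :=
  [set v | exists (s : R) (xi : 'cV[R]_n),
     [/\ dot (c1 q) xi = 0, dot (c2 q) xi = 0,
         c1 v = xi - s *: c2 q & c2 v = s *: c1 q]].

Definition fiber_metric (R : realType) (n : nat)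
    (D : config R n -> set (config R n))
    (g : config R n -> config R n -> config R n -> R) : Prop :=
  forall q, stiefel q ->
  [/\ forall u v, D q u -> D q v -> g q u v = g q v u,
      forall k u v w, D q u -> D q v -> D q w ->
        g q (k *: u + v) w = k * g q u w + g q v w
    & forall u, D q u -> u != 0 -> 0 < g q u u].

(* SO(n) is transitive on V_(n,2) for n >= 3, so invariance forces the
   smoothness of the metric. *)
Definition so_invariant (R : realType) (n : nat)
    (D : config R n -> set (config R n))
    (g : config R n -> config R n -> config R n -> R) : Prop :=
  forall Q : 'M[R]_n, Q^T *m Q = 1%:M -> \det Q = 1 ->
  forall q, stiefel q ->
  forall u v, D q u -> D q v ->
    [/\ D (Q *m q) (Q *m u) & g (Q *m q) (Q *m u) (Q *m v) = g q u v].

Definition pairing (R : realType) (n : nat) (p v : config R n) : R :=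
  dot (c1 p) (c1 v) + dot (c2 p) (c2 v).

(* H(q, p) = max over v in D_q of p(v) - g(v, v) / 2. *)
Definition geodesic_hamiltonian (R : realType) (n : nat)
    (D : config R n -> set (config R n))
    (g : config R n -> config R n -> config R n -> R)
    (H : phase R n -> R) : Prop :=
  forall x, cotangent_bundle x ->
    (forall v, D (base x) v ->
       pairing (momentum x) v - 1 / 2 * g (base x) v v <= H x) /\
    (exists2 v, D (base x) v &
       pairing (momentum x) v - 1 / 2 * g (base x) v v = H x).

Definition invariant_sR (R : realType) (n : nat)
    (D : config R n -> set (config R n))
    (g : config R n -> config R n -> config R n -> R)
    (H : phase R n -> R) : Prop :=
  [/\ fiber_metric D g, so_invariant D g & geodesic_hamiltonian D g H].

Definition H_contact (R : realType) (n : nat) (a1 a2 a4 : R)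
    (x : phase R n) : R :=
  1 / 2 * a1 * dot (p1 x) (p1 x) + 1 / 2 * a2 * dot (p2 x) (p2 x)
  + 1 / 2 * (a1 + a2) * (dot (p1 x) (e2 x) * dot (p2 x) (e1 x))
  + a4 * dot (p1 x) (p2 x).

Definition H_D0 (R : realType) (n : nat) (a1 a3 : R) (x : phase R n) : R :=
  1 / 2 * a1 * dot (p1 x) (p1 x)
  + a3 * (dot (p1 x) (e2 x) * dot (p2 x) (e1 x)).

Lemma span_setP (R : realType) (V : vectType R) (S : set V) : is_span S (span_set S).
Proof.
suff [U hU] : exists U, is_span S U by rewrite /span_set; case: xgetP => // /(_ U).
pose P d := `[< exists s : seq V, (forall v, v \in s -> S v) /\ \dim (span s) = d >].
have exP : exists d, P d.
  by exists (\dim (span ([::] : seq V))); apply/asboolP; exists [::].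
have bP d : P d -> (d <= \dim (fullv : {vspace V}))%N.
  by move/asboolP => [s [_ <-]]; apply: dimvS; exact: subvf.
case: (ex_maxnP exP bP) => d /asboolP[s [sS sd]] dmax.
exists (span s); split => [v Sv|W hW].
  have : (\dim (span (v :: s)) <= d)%N.
    apply: dmax; apply/asboolP; exists (v :: s); split => // w.
    by rewrite inE => /orP[/eqP->//|/sS].
  rewrite -sd => le.
  have sub : (span s <= span (v :: s))%VS by rewrite span_cons addvSr.
  have /eqP-> : span s == span (v :: s) by rewrite eqEdim sub.
  by apply: memv_span; rewrite inE eqxx.
by apply/span_subvP => v /sS/hW.
Qed.

Section Sanity.
Variables (R : realType) (n : nat).
Implicit Types (x u v w : phase R n) (q : config R n) (a b c : 'cV[R]_n).

Lemma dotE a b : dot a b = \sum_i a i 0 * b i 0.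
Proof. by rewrite /dot mxE; apply: eq_bigr => i _; rewrite mxE. Qed.

Lemma dotC a b : dot a b = dot b a.
Proof. by rewrite !dotE; apply: eq_bigr => i _; rewrite mulrC. Qed.

Lemma dotDl a b c : dot (a + b) c = dot a c + dot b c.
Proof. by rewrite /dot linearD mulmxDl mxE. Qed.

Lemma dotZl k a c : dot (k *: a) c = k * dot a c.
Proof. by rewrite /dot linearZ -scalemxAl mxE. Qed.

Lemma dotDr a b c : dot c (a + b) = dot c a + dot c b.
Proof. by rewrite dotC dotDl !(dotC c). Qed.

Lemma dotZr k a c : dot c (k *: a) = k * dot c a.
Proof. by rewrite dotC dotZl (dotC c). Qed.

Lemma dotNl a c : dot (- a) c = - dot a c.
Proof. by rewrite -scaleN1r dotZl mulN1r. Qed.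

Lemma dotNr a c : dot c (- a) = - dot c a.
Proof. by rewrite dotC dotNl dotC. Qed.

Lemma dot0r a : dot a 0 = 0.
Proof. by rewrite -(scale0r a) dotZr mul0r. Qed.

Lemma dot0l a : dot 0 a = 0.
Proof. by rewrite dotC dot0r. Qed.

Lemma dot_ge0 a : 0 <= dot a a.
Proof. by rewrite dotE; apply: sumr_ge0 => i _; rewrite -expr2 sqr_ge0. Qed.

Lemma dot_eq0 a : dot a a = 0 -> a = 0.
Proof.
rewrite dotE => /eqP; rewrite psumr_eq0 => [/allP h|i _]; last first.
  by rewrite -expr2 sqr_ge0.
apply/matrixP => i j; rewrite ord1 mxE.
by have := h i (mem_index_enum i); rewrite /= mulf_eq0 orbb => /eqP.
Qed.

Definition dot_lin :=
  (dotDl, dotDr, dotZl, dotZr, dotNl, dotNr, dot0l, dot0r).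

Lemma c1D q q' : c1 (q + q') = c1 q + c1 q'. Proof. exact: linearD. Qed.
Lemma c2D q q' : c2 (q + q') = c2 q + c2 q'. Proof. exact: linearD. Qed.
Lemma c1Z k q : c1 (k *: q) = k *: c1 q. Proof. exact: linearZ. Qed.
Lemma c2Z k q : c2 (k *: q) = k *: c2 q. Proof. exact: linearZ. Qed.

Lemma e1P k u v : e1 (k *: u + v) = k *: e1 u + e1 v.
Proof. by rewrite /e1 /base linearP c1D c1Z. Qed.
Lemma e2P k u v : e2 (k *: u + v) = k *: e2 u + e2 v.
Proof. by rewrite /e2 /base linearP c2D c2Z. Qed.
Lemma p1P k u v : p1 (k *: u + v) = k *: p1 u + p1 v.
Proof. by rewrite /p1 /momentum linearP c1D c1Z. Qed.
Lemma p2P k u v : p2 (k *: u + v) = k *: p2 u + p2 v.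
Proof. by rewrite /p2 /momentum linearP c2D c2Z. Qed.

Definition mkc a b : config R n := \matrix_(i, j) (if j == 0 then a i 0 else b i 0).
Definition mkp (qe qp : config R n) : phase R n := row_mx qe qp.

Lemma c1_mk a b : c1 (mkc a b) = a.
Proof. by apply/matrixP => i j; rewrite !mxE ord1. Qed.
Lemma c2_mk a b : c2 (mkc a b) = b.
Proof. by apply/matrixP => i j; rewrite !mxE ord1. Qed.
Lemma config_eq q q' : c1 q = c1 q' -> c2 q = c2 q' -> q = q'.
Proof.
move=> h1 h2; apply/matrixP => i j.
have [->|->] : j = 0 \/ j = 1.
  by case: j => [[|[|]]] // hj; [left|right]; apply: val_inj.
- by have /matrixP/(_ i 0) := h1; rewrite !mxE.
- by have /matrixP/(_ i 0) := h2; rewrite !mxE.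
Qed.
Lemma phase_eq u v :
  e1 u = e1 v -> e2 u = e2 v -> p1 u = p1 v -> p2 u = p2 v -> u = v.
Proof.
move=> h1 h2 h3 h4; rewrite -[u]hsubmxK -[v]hsubmxK.
by congr row_mx; apply: config_eq.
Qed.

Lemma coord_diff x (i : 'I_n) j :
  is_diff x (fun y : phase R n => y i j : R) (fun v => v i j).
Proof.
have @f : {linear phase R n -> R}.
  by exists (fun N : phase R n => N i j); do 2![eexists]; do ?[constructor];
     rewrite ?mxE// => ? *; rewrite ?mxE//; move=> ?; rewrite !mxE.
rewrite (_ : (fun _ => _) = f) //.
have fc : continuous f by exact: coord_continuous.
by apply: DiffDef; [exact: linear_differentiable|rewrite diff_lin].
Qed.

Lemma dot_diff x (j k : 'I_(2 + 2)) :
  is_diff x (fun y => dot (col j y) (col k y) : R)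
    (fun v => dot (col j v) (col k x) + dot (col j x) (col k v)).
Proof.
have H (r : seq 'I_n) : is_diff x (fun y => \sum_(i <- r) y i j * y i k : R)
    (fun v => \sum_(i <- r) (v i j * x i k + x i j * v i k)).
  elim: r => [|i r ih].
    have -> : (fun y : phase R n => \sum_(i <- [::]) y i j * y i k) = cst 0.
      by apply/funext => y; rewrite big_nil.
    have -> : (fun v : phase R n => \sum_(i <- [::]) (v i j * x i k + x i j * v i k)) = 0.
      by apply/funext => y; rewrite big_nil.
    exact: is_diff_cst.
  have -> : (fun y : phase R n => \sum_(l <- i :: r) y l j * y l k)
    = (fun y : phase R n => y i j : R) * (fun y => y i k : R)
     + (fun y => \sum_(i <- r) y i j * y i k).
    by apply/funext => y; rewrite big_cons.
  have hj := coord_diff x i j; have hk := coord_diff x i k.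
  apply: is_diff_eq; apply/funext => v /=; rewrite big_cons.
  rewrite -[LHS]/((x i j * v i k + x i k * v i j) + \sum_(i <- r) (v i j * x i k + x i j * v i k)).
  by congr (_ + _); rewrite addrC [x i k * _]mulrC.
have := H (index_enum 'I_n).
have -> : (fun y : phase R n => \sum_i y i j * y i k) = fun y => dot (col j y) (col k y).
  by apply/funext => y; rewrite dotE; apply: eq_bigr => i _; rewrite !mxE.
have -> // : (fun v : phase R n => \sum_i (v i j * x i k + x i j * v i k)) =
  fun v => dot (col j v) (col k x) + dot (col j x) (col k v).
apply/funext => v; rewrite !dotE -big_split.
by apply: eq_bigr => i _; rewrite !mxE.
Qed.

Lemma e1E u : e1 u = col (lshift 2 0) u.
Proof. by apply/matrixP => i j; rewrite !mxE. Qed.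
Lemma e2E u : e2 u = col (lshift 2 1) u.
Proof. by apply/matrixP => i j; rewrite !mxE. Qed.
Lemma p1E u : p1 u = col (rshift 2 0) u.
Proof. by apply/matrixP => i j; rewrite !mxE. Qed.
Lemma p2E u : p2 u = col (rshift 2 1) u.
Proof. by apply/matrixP => i j; rewrite !mxE. Qed.

Lemma tangentP x v : reflect
  [/\ [/\ dot (e1 x) (e1 v) = 0, dot (e2 x) (e2 v) = 0
        & dot (e1 x) (e2 v) + dot (e2 x) (e1 v) = 0],
      dot (e1 x) (p1 v) + dot (p1 x) (e1 v) = 0,
      dot (e2 x) (p2 v) + dot (p2 x) (e2 v) = 0
    & dot (e1 x) (p2 v) + dot (p2 x) (e1 v)
      + (dot (e2 x) (p1 v) + dot (p1 x) (e2 v)) = 0]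
  (v \in tangent x).
Proof.
have K (f df : phase R n -> R) : is_diff x f df ->
    (v \in lker (linfun ('d f x : phase R n -> R^o))) = (df v == 0).
  by move=> h; rewrite memv_ker lfunE /= diff_val.
have S (f g df dg : phase R n -> R) : is_diff x f df -> is_diff x g dg ->
    is_diff x (fun y => f y + g y) (fun v => df v + dg v).
  by move=> hf hg; exact: is_diffD.
have Q (s : seq (phase R n -> R)) :
    (v \in (\bigcap_(h <- s) lker (linfun ('d h x : phase R n -> R^o)))%VS)
    = all (fun h : phase R n -> R => v \in lker (linfun ('d h x : phase R n -> R^o))) s.
  elim: s => [|h s ih]; first by rewrite big_nil memvf.
  by rewrite big_cons memv_cap ih.
have A6 (T : Type) (h : pred T) t1 t2 t3 t4 t5 t6 :
    all h [:: t1; t2; t3; t4; t5; t6]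
    = [&& h t1, h t2, h t3, h t4, h t5 & h t6] by rewrite /= andbT.
have dd (f g : phase R n -> 'cV[R]_n) j k : f = col j -> g = col k ->
    is_diff x (fun y => dot (f y) (g y))
      (fun v => dot (f v) (g x) + dot (f x) (g v)).
  by move=> -> ->; exact: dot_diff.
have E1 := funext e1E; have E2 := funext e2E.
have P1 := funext p1E; have P2 := funext p2E.
have -> : (v \in tangent x) =
   [&& dot (e1 v) (e1 x) + dot (e1 x) (e1 v) == 0,
       dot (e2 v) (e2 x) + dot (e2 x) (e2 v) == 0,
       dot (e1 v) (e2 x) + dot (e1 x) (e2 v) == 0,
       dot (e1 v) (p1 x) + dot (e1 x) (p1 v) == 0,
       dot (e2 v) (p2 x) + dot (e2 x) (p2 v) == 0
     & (dot (e1 v) (p2 x) + dot (e1 x) (p2 v))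
       + (dot (e2 v) (p1 x) + dot (e2 x) (p1 v)) == 0].
  refine (etrans (Q (constraints R n)) (etrans (A6 _ _ _ _ _ _ _ _) _)).
  refine (f_equal2 andb (K _ _ (dd (@e1 R n) (@e1 R n) _ _ E1 E1)) _).
  refine (f_equal2 andb (K _ _ (dd (@e2 R n) (@e2 R n) _ _ E2 E2)) _).
  refine (f_equal2 andb (K _ _ (dd (@e1 R n) (@e2 R n) _ _ E1 E2)) _).
  refine (f_equal2 andb (K _ _ (dd (@e1 R n) (@p1 R n) _ _ E1 P1)) _).
  refine (f_equal2 andb (K _ _ (dd (@e2 R n) (@p2 R n) _ _ E2 P2)) _).
  exact: (K _ _ (S _ _ _ _ (dd (@e1 R n) (@p2 R n) _ _ E1 P2) (dd (@e2 R n) (@p1 R n) _ _ E2 P1))).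
rewrite !(dotC _ (e1 x)) !(dotC _ (e2 x)) !(dotC _ (p1 x)) !(dotC _ (p2 x)).
apply: (iffP idP).
- case/and5P => /eqP h1 /eqP h2 /eqP h3 /eqP h4 /andP[/eqP h5 /eqP h6].
  split; [split|..]; lra.
- move=> [[h1 h2 h3] h4 h5 h6].
  by apply/and5P; split; [..|apply/andP; split]; apply/eqP; lra.
Qed.

Section Nondegeneracy.
Variables (eta : R) (x : phase R n).

Fact omega_linr (u : subvs_of (tangent x)) :
  linear (fun v : subvs_of (tangent x) => omega eta (vsval u) (vsval v) : R^o).
Proof.
move=> k v w; rewrite /omega linearP e1P e2P p1P p2P !dot_lin.
rewrite -[k *: _]/(k * _); ring.
Qed.

Lemma flat1E (u v : subvs_of (tangent x)) :
  (linfun (fun v : subvs_of (tangent x) =>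
     omega eta (vsval u) (vsval v) : R^o) : cotangent x) v
  = omega eta (vsval u) (vsval v).
Proof.
pose m := GRing.isLinear.Build R _ _ _ _ (omega_linr u).
pose f : {linear subvs_of (tangent x) -> R^o} := HB.pack (fun v : subvs_of (tangent x) =>
     omega eta (vsval u) (vsval v) : R^o) m.
exact: (lfunE f v).
Qed.

Fact omega_linl : linear (fun u : subvs_of (tangent x) =>
    linfun (fun v : subvs_of (tangent x) =>
      omega eta (vsval u) (vsval v) : R^o) : cotangent x).
Proof.
move=> k u w; apply/lfunP => v; rewrite add_lfunE scale_lfunE !flat1E.
rewrite /omega linearP e1P e2P p1P p2P !dot_lin -[k *: _]/(k * _); ring.
Qed.

Lemma flatE (u v : subvs_of (tangent x)) : flat eta x u v = omega eta (vsval u) (vsval v).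
Proof.
pose m := GRing.isLinear.Build R _ _ _ _ omega_linl.
pose f : {linear subvs_of (tangent x) -> cotangent x} :=
  HB.pack (fun u : subvs_of (tangent x) =>
    linfun (fun v : subvs_of (tangent x) =>
      omega eta (vsval u) (vsval v) : R^o) : cotangent x) m.
by rewrite -(flat1E u v); congr (fun_of_lfun _ v); exact: (lfunE f u).
Qed.

Lemma omega_nondegenerate u : cotangent_bundle x -> u \in tangent x ->
  (forall v, v \in tangent x -> omega eta u v = 0) -> u = 0.
Proof.
move=> [[h11 h22 h12] k1 k2 k12] /tangentP[[u1 u2 u3] u4 u5 u6] H.
rewrite -/(e1 x) -/(e2 x) in h11 h22 h12.
have z1 : e1 (mkp 0 (base u)) = 0 by rewrite /e1 /base row_mxKl /c1 /c2 linear0.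
have z2 : e2 (mkp 0 (base u)) = 0 by rewrite /e2 /base row_mxKl /c1 /c2 linear0.
have z3 : p1 (mkp 0 (base u)) = e1 u by rewrite /p1 /momentum row_mxKr.
have z4 : p2 (mkp 0 (base u)) = e2 u by rewrite /p2 /momentum row_mxKr.
have : omega eta u (mkp 0 (base u)) = 0.
  by apply: H; apply/tangentP; rewrite z1 z2 z3 z4 !dot_lin; split; [split|..]; lra.
rewrite /omega z1 z2 z3 z4 !dot_lin => h.
have d1 := dot_ge0 (e1 u); have d2 := dot_ge0 (e2 u).
have a1 : e1 u = 0 by apply: dot_eq0; lra.
have a2 : e2 u = 0 by apply: dot_eq0; lra.
rewrite a1 a2 !dot_lin in u4 u5 u6.
pose s1 := - dot (p1 x) (p1 u); pose s2 := - dot (p2 x) (p2 u).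
pose s3 := - (dot (p2 x) (p1 u) + dot (p1 x) (p2 u)).
pose w := mkp (momentum u) (mkc (s1 *: e1 x + s3 *: e2 x) (s2 *: e2 x)).
have y1 : e1 w = p1 u by rewrite /e1 /base row_mxKl.
have y2 : e2 w = p2 u by rewrite /e2 /base row_mxKl.
have y3 : p1 w = s1 *: e1 x + s3 *: e2 x by rewrite /p1 /momentum row_mxKr c1_mk.
have y4 : p2 w = s2 *: e2 x by rewrite /p2 /momentum row_mxKr c2_mk.
have : omega eta u w = 0.
  apply: H; apply/tangentP; rewrite y1 y2 y3 y4 !dot_lin (dotC (e2 x) (e1 x)).
  by rewrite h11 h22 h12 /s1 /s2 /s3; split; [split|..]; lra.
rewrite /omega y1 y2 a1 a2 !dot_lin => h'.
have g1 := dot_ge0 (p1 u); have g2 := dot_ge0 (p2 u).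
have b1 : p1 u = 0 by apply: dot_eq0; lra.
have b2 : p2 u = 0 by apply: dot_eq0; lra.
by apply: phase_eq; rewrite ?a1 ?a2 ?b1 ?b2 /e1 /e2 /p1 /p2 /base /momentum /c1 /c2 !linear0.
Qed.

Lemma ham_vectorP (b : cotangent x) (v : subvs_of (tangent x)) :
  cotangent_bundle x ->
  omega eta (vsval (ham_vector eta b)) (vsval v) = - b v.
Proof.
move=> Mx.
have K : lker (flat eta x) == 0%VS.
  rewrite -subv0; apply/subvP => u; rewrite memv_ker memv0 => /eqP hu.
  apply/eqP/val_inj; rewrite -[RHS]/(0 : phase R n); apply: omega_nondegenerate => //.
    exact: subvsP.
  move=> w hw; rewrite -(vsprojK hw) -flatE hu; exact: lfunE.
have dimE : \dim (fullv : {vspace cotangent x}) = \dim (fullv : {vspace subvs_of (tangent x)}).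
  by rewrite !dimvf /dim /= muln1.
have L : limg (flat eta x) = fullv.
  apply/eqP; rewrite eqEdim subvf /= limg_dim_eq ?dimE //.
  by rewrite (eqP K) capv0.
rewrite -flatE /ham_vector linearN opp_lfunE; congr (- _).
have h : b \in limg (flat eta x) by rewrite L memvf.
exact: (congr1 (fun h : cotangent x => h v) (limg_lfunVK h)).
Qed.
End Nondegeneracy.

(* The sub-Riemannian metrics determined by the two families of Hamiltonians. *)
Definition contact_metric (a1 a2 a4 : R) (q u v : config R n) : R :=
  (a2 * dot (c1 u) (c1 v) - a4 * (dot (c1 u) (c2 v) + dot (c2 u) (c1 v))
   + a1 * dot (c2 u) (c2 v)) / (a1 * a2 - a4 ^+ 2).

Definition D0_metric (a1 a3 : R) (q u v : config R n) : R :=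
  (dot (c1 u) (c1 v) - dot (c1 q) (c2 u) * dot (c1 q) (c2 v)) / a1
  + 4 / (a1 - 2 * a3) * (dot (c1 q) (c2 u) * dot (c1 q) (c2 v)).

Lemma dot_orth (Q : 'M[R]_n) a b : Q^T *m Q = 1%:M ->
  dot (Q *m a) (Q *m b) = dot a b.
Proof.
by move=> h; rewrite /dot trmx_mul mulmxA -(mulmxA a^T) h mulmx1.
Qed.
Lemma c1M (Q : 'M[R]_n) q : c1 (Q *m q) = Q *m c1 q.
Proof. by rewrite /c1 /c2 !colE mulmxA. Qed.
Lemma c2M (Q : 'M[R]_n) q : c2 (Q *m q) = Q *m c2 q.
Proof. by rewrite /c1 /c2 !colE mulmxA. Qed.

Lemma contact_invariant_sR (a1 a2 a4 : R) :
  0 < a1 -> 0 < a2 -> a4 ^+ 2 < a1 * a2 ->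
  invariant_sR (@contact_distribution R n) (contact_metric a1 a2 a4)
    (@H_contact R n a1 a2 a4).
Proof.
move=> ha1 ha2; set k := a1 * a2 - a4 ^+ 2; rewrite -subr_gt0 -/k => hk.
have k0 : k != 0 by rewrite gt_eqF.
have pos (w : config R n) : 0 <= contact_metric a1 a2 a4 0 w w /\
   (contact_metric a1 a2 a4 0 w w = 0 -> w = 0).
  have E : contact_metric a1 a2 a4 0 w w =
    (dot (a2 *: c1 w - a4 *: c2 w) (a2 *: c1 w - a4 *: c2 w)
      + k * dot (c2 w) (c2 w)) / (a2 * k).
    rewrite /contact_metric !dot_lin (dotC (c2 w) (c1 w)) -/k.
    by rewrite {2}/k; field; rewrite k0 gt_eqF.
  have h1 := dot_ge0 (a2 *: c1 w - a4 *: c2 w).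
  have h2 : 0 <= k * dot (c2 w) (c2 w) by rewrite mulr_ge0 ?dot_ge0 // ltW.
  have h3 : 0 < a2 * k by rewrite mulr_gt0.
  rewrite E; split; first by rewrite divr_ge0 ?addr_ge0 // ltW.
  move/eqP; rewrite mulf_eq0 invr_eq0 (gt_eqF h3) orbF => /eqP h.
  have z : c2 w = 0.
    apply: dot_eq0; apply/eqP.
    have : k * dot (c2 w) (c2 w) == 0 by apply/eqP; lra.
    by rewrite mulf_eq0 (negbTE k0).
  have : a2 *: c1 w = 0.
    apply: dot_eq0; move: h; rewrite z !dot_lin; lra.
  move/eqP; rewrite scaler_eq0 (gt_eqF ha2) /= => /eqP z'.
  by apply: config_eq; rewrite ?z ?z' /c1 /c2 linear0.
split.
- move=> q _; split.
  + move=> u v _ _; rewrite /contact_metric (dotC (c1 v)) (dotC (c1 v) (c2 u)).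
    by rewrite (dotC (c2 v)) (dotC (c2 v) (c2 u)); congr (_ / _); ring.
  + move=> t u v w _ _ _; rewrite /contact_metric !(c1D, c2D, c1Z, c2Z) !dot_lin.
    by ring.
  + move=> u _ u0; have [h1 h2] := pos u.
    rewrite lt_neqAle h1 andbT; apply/eqP => h.
    by case/eqP: u0; apply: h2.
- move=> Q hQ _ q _ u v [u1 u2 u3 u4] _.
  rewrite /contact_distribution /= /contact_metric !(c1M, c2M) !dot_orth //.
- move=> x [[h11 h22 h12] k1 k2 k12]; rewrite -/(e1 x) -/(e2 x) in h11 h22 h12.
  pose q1 := p1 x - dot (e2 x) (p1 x) *: e2 x.
  pose q2 := p2 x - dot (e1 x) (p2 x) *: e1 x.
  have q11 : dot (e1 x) q1 = 0 by rewrite !dot_lin h12 k1; lra.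
  have q12 : dot (e2 x) q1 = 0 by rewrite !dot_lin h22; lra.
  have q21 : dot (e1 x) q2 = 0 by rewrite !dot_lin h11; lra.
  have q22 : dot (e2 x) q2 = 0 by rewrite !dot_lin (dotC (e2 x) (e1 x)) h12 k2; lra.
  pose v0 := mkc (a1 *: q1 + a4 *: q2) (a4 *: q1 + a2 *: q2).
  have key (v : config R n) : contact_distribution (base x) v ->
      pairing (momentum x) v - 1 / 2 * contact_metric a1 a2 a4 (base x) v v
      = H_contact a1 a2 a4 x - 1 / 2 * contact_metric a1 a2 a4 0 (v - v0) (v - v0).
    rewrite /contact_distribution /= -/(e1 x) -/(e2 x) => -[v11 v12 v21 v22].
    rewrite /pairing -/(p1 x) -/(p2 x).
    have pe1 : p1 x = q1 + dot (e2 x) (p1 x) *: e2 x by rewrite subrK.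
    have pe2 : p2 x = q2 + dot (e1 x) (p2 x) *: e1 x by rewrite subrK.
    set m1 := dot (e2 x) (p1 x) in pe1 k12; set m2 := dot (e1 x) (p2 x) in pe2 k12.
    have em : m2 = - m1 by lra.
    rewrite /H_contact pe1 pe2 em /contact_metric.
    have -> : c1 (v - v0) = c1 v - (a1 *: q1 + a4 *: q2).
      by rewrite -(c1_mk (a1 *: q1 + a4 *: q2) (a4 *: q1 + a2 *: q2)); exact: linearB.
    have -> : c2 (v - v0) = c2 v - (a4 *: q1 + a2 *: q2).
      by rewrite -(c2_mk (a1 *: q1 + a4 *: q2) (a4 *: q1 + a2 *: q2)); exact: linearB.
    clearbody q1 q2; rewrite !dot_lin.
    rewrite !(dotC _ (e1 x)) !(dotC _ (e2 x)) h11 h22 !(dotC (e2 x) (e1 x)) h12.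
    rewrite ?q11 ?q12 ?q21 ?q22 ?v11 ?v12 ?v21 ?v22.
    rewrite (dotC (c1 v) q1) (dotC (c1 v) q2) (dotC (c2 v) q1) (dotC (c2 v) q2).
    rewrite (dotC q2 q1) (dotC (c2 v) (c1 v)) -/k.
    rewrite /k; field; exact: k0.
  split => [v hv|].
    rewrite key // gerBl; apply: mulr_ge0; first by rewrite divr_ge0.
    by have [] := pos (v - v0).
  exists v0.
    rewrite /contact_distribution /= -/(e1 x) -/(e2 x) c1_mk c2_mk !dot_lin.
    by rewrite !dot_lin in q11 q12 q21 q22 *; split; nra.
  rewrite key; last first.
    rewrite /contact_distribution /= -/(e1 x) -/(e2 x) c1_mk c2_mk !dot_lin.
    by rewrite !dot_lin in q11 q12 q21 q22 *; split; nra.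
  rewrite subrr /contact_metric /c1 /c2 !linear0 !dot_lin; lra.
Qed.

Lemma D0_invariant_sR (a1 a3 : R) : 0 < a1 -> 2 * a3 < a1 ->
  invariant_sR (@D0_distribution R n) (D0_metric a1 a3) (@H_D0 R n a1 a3).
Proof.
move=> ha1; rewrite -subr_gt0; set k := a1 - 2 * a3 => hk.
have k0 : k != 0 by rewrite gt_eqF.
have a0 : a1 != 0 by rewrite gt_eqF.
have inD q s xi : dot (c1 q) xi = 0 -> dot (c2 q) xi = 0 ->
    D0_distribution q (mkc (xi - s *: c2 q) (s *: c1 q)).
  by move=> h1 h2; exists s, xi; rewrite c1_mk c2_mk.
have metE q s xi (u : config R n) : stiefel q -> dot (c1 q) xi = 0 -> dot (c2 q) xi = 0 ->
    c1 u = xi - s *: c2 q -> c2 u = s *: c1 q ->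
    D0_metric a1 a3 q u u = dot xi xi / a1 + 4 / k * s ^+ 2.
  move=> [h11 h22 h12] x1 x2 u1 u2; rewrite /D0_metric u1 u2 -/k.
  rewrite !dot_lin !(dotC _ (c2 q)) h11 h22 x2.
  by field; rewrite k0 a0.
split.
- move=> q Sq; split.
  + move=> u v _ _; rewrite /D0_metric (dotC (c1 v) (c1 u)).
    by congr (_ / _ + _ * _); ring.
  + move=> t u v w _ _ _; rewrite /D0_metric !(c1D, c2D, c1Z, c2Z) !dot_lin; ring.
  + move=> u [s [xi [x1 x2 ue1 ue2]]] u0.
    rewrite (metE q s xi u) //.
    have g1 : 0 <= dot xi xi / a1 by rewrite divr_ge0 ?dot_ge0 // ltW.
    have g3 : 0 < 4 / k by rewrite divr_gt0.
    have g2 : 0 <= 4 / k * s ^+ 2 by rewrite mulr_ge0 ?sqr_ge0 // ltW.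
    rewrite lt_neqAle addr_ge0 // andbT; apply/eqP => h.
    case/eqP: u0.
    have s0 : s = 0.
      have : 4 / k * s ^+ 2 == 0 by apply/eqP; lra.
      by rewrite mulf_eq0 (gt_eqF g3) sqrf_eq0 /= => /eqP.
    have xi0 : xi = 0.
      apply: dot_eq0; apply/eqP.
      have : dot xi xi / a1 == 0 by apply/eqP; lra.
      by rewrite mulf_eq0 invr_eq0 (negbTE a0) orbF.
    apply: config_eq; rewrite ?ue1 ?ue2 s0 ?xi0 !scale0r ?subr0 /c1 /c2 linear0 //.
- move=> Q hQ _ q _ u v [s [xi [x1 x2 ue1 ue2]]] _; split.
    exists s, (Q *m xi); rewrite !(c1M, c2M) !dot_orth //; split=> //.
      by rewrite ue1 mulmxBr scalemxAr.
    by rewrite ue2 scalemxAr.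
  by rewrite /D0_metric !(c1M, c2M) !dot_orth.
- move=> x [Sq k1 k2 k12]; have [h11 h22 h12] := Sq.
  rewrite -/(e1 x) -/(e2 x) in h11 h22 h12.
  pose m := dot (e2 x) (p1 x).
  pose q1 := p1 x - m *: e2 x.
  have q11 : dot (e1 x) q1 = 0 by rewrite !dot_lin h12 k1; lra.
  have q12 : dot (e2 x) q1 = 0 by rewrite !dot_lin h22 /m; lra.
  have key (v : config R n) s xi : dot (e1 x) xi = 0 -> dot (e2 x) xi = 0 ->
      c1 v = xi - s *: e2 x -> c2 v = s *: e1 x ->
      pairing (momentum x) v - 1 / 2 * D0_metric a1 a3 (base x) v v
      = H_D0 a1 a3 x - (dot (xi - a1 *: q1) (xi - a1 *: q1) / (2 * a1)
           + 2 / k * (s + k / 2 * m) ^+ 2).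
    move=> x1 x2 v1 v2; rewrite (metE _ s xi) //.
    rewrite /pairing -/(p1 x) -/(p2 x) v1 v2.
    have pe1 : p1 x = q1 + m *: e2 x by rewrite subrK.
    have em : dot (e1 x) (p2 x) = - m by rewrite /m; lra.
    clearbody q1 m; rewrite /H_D0 pe1 !dot_lin !(dotC _ (e1 x)) em.
    rewrite !(dotC _ (e2 x)) ?(dotC (e2 x) (e1 x)) ?h11 h22 ?h12 ?q11 ?q12 ?x1 x2.
    rewrite (dotC q1 xi).
    by rewrite /k in k0 *; field; rewrite k0 a0.
  split => [v [s [xi [x1 x2 v1 v2]]]|].
    rewrite (key _ s xi) // gerBl addr_ge0 //.
      by rewrite divr_ge0 ?dot_ge0 // mulr_ge0 // ltW.
    by rewrite mulr_ge0 ?sqr_ge0 // divr_ge0 // ltW.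
  pose s := - (k / 2 * m).
  exists (mkc (a1 *: q1 - s *: e2 x) (s *: e1 x)).
    by apply: inD; rewrite dotZr -/(e1 x) -/(e2 x) ?q11 ?q12 mulr0.
  rewrite (key _ s (a1 *: q1)) ?c1_mk ?c2_mk ?dotZr ?q11 ?q12 ?mulr0 //.
  by rewrite subrr dot_lin /s addNr expr0n /= mulr0 mul0r addr0 subr0.
Qed.
End Sanity.

(* Main.v *)
Require Import Defs.
From HB Require Import structures.
From mathcomp Require Import all_boot all_order all_algebra.
From mathcomp Require Import all_classical all_reals all_analysis.
From mathcomp Require Import ring lra.
Set Implicit Arguments.
Unset Strict Implicit.
Unset Printing Implicit Defensive.
Import Order.TTheory GRing.Theory Num.Theory numFieldNormedType.Exports.
Local Open Scope classical_set_scope.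
Local Open Scope ring_scope.

(* Write x = (e1, e2, p1, p2) as an n x 4 matrix and let so_orbit x = so(n) x.
   The Hamiltonian vectors of the components of Phi span so_orbit x, so the
   differentials of the algebra correspond under omega to
   W = so_orbit x + <X_H>, and completeness means that W is coisotropic.
   The Gram matrix of x separates infinitesimal rotations, hence so_orbit x has
   codimension 4 in the tangent space (3 when n = 3) at a generic point.  As H
   is invariant, W then has codimension 3 (2 when n = 3) as soon as X_H is not
   tangent to the SO(n)-orbit.  The skew complement of W, of dimension 3 (2),
   contains X_H, Phi x and Phi^3 x (X_H and Phi x when n = 3), which all lie in
   W: the linear field Phi^(2k+1) x is omega-orthogonal to so_orbit x because
   Phi^(2k+1) commutes with Phi, and to X_H because H is invariant.  They are
   independent where <p1, p2> != 0 and the Gram determinant does not vanish.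
   X_H is transverse to the orbit because H is not preserved by the right
   SO(2)-action (spin), whose moment is <p1, e2>; in the remaining isotropic
   case X_H is an explicit combination of Phi x and spin x.  All genericity
   conditions are polynomial, so one good point in each fibre of the cotangent
   bundle gives density. *)

(** * Polynomial and smooth functions *)

Section Generated.
Variables (R : realType) (n : nat).
Implicit Types (S : set (phase R n -> R)) (f g : phase R n -> R).

Lemma sub_generated S : S `<=` generated_algebra S.
Proof. exact: sub_smallest. Qed.

Lemma generated_ind S (P : set (phase R n -> R)) :
  function_algebra P -> S `<=` P -> generated_algebra S `<=` P.
Proof. by move=> aP SP; apply: smallest_sub. Qed.

Lemma generated_function_algebra S : function_algebra (generated_algebra S).
Proof.
split.
- by move=> k M [[cM _ _] _]; exact: cM.
- by move=> f g Ff Fg M HM; have [[_ aM _] _] := HM; apply: aM; [exact: Ff|exact: Fg].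
- by move=> f g Ff Fg M HM; have [[_ _ mM] _] := HM; apply: mM; [exact: Ff|exact: Fg].
Qed.

Section Closure.
Variables (F : set (phase R n -> R)) (aF : function_algebra F).

Lemma algebra_cst k : F (fun=> k). Proof. by case: aF. Qed.
Lemma algebra_add f g : F f -> F g -> F (fun x => f x + g x).
Proof. by case: aF => _ h _; exact: h. Qed.
Lemma algebra_mul f g : F f -> F g -> F (fun x => f x * g x).
Proof. by case: aF => _ _ h; exact: h. Qed.
Lemma algebra_scale k f : F f -> F (fun x => k * f x).
Proof. by apply: algebra_mul; exact: algebra_cst. Qed.
Lemma algebra_opp f : F f -> F (fun x => - f x).
Proof.
move=> Ff; have -> : (fun x => - f x) = (fun x => -1 * f x); last exact: algebra_scale.
by apply/funext => x; rewrite mulN1r.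
Qed.
Lemma algebra_sub f g : F f -> F g -> F (fun x => f x - g x).
Proof. by move=> Ff Fg; apply: algebra_add => //; exact: algebra_opp. Qed.
Lemma algebra_sum (I : Type) (r : seq I) (f : I -> phase R n -> R) :
  (forall i, F (f i)) -> F (fun x => \sum_(i <- r) f i x).
Proof.
move=> Ff; elim: r => [|i r ih].
  have -> : (fun x => \sum_(i <- [::]) f i x) = fun=> 0.
    by apply/funext => x; rewrite big_nil.
  exact: algebra_cst.
have -> : (fun x => \sum_(l <- i :: r) f l x) =
    (fun x => f i x + \sum_(l <- r) f l x).
  by apply/funext => x; rewrite big_cons.
exact: algebra_add.
Qed.
End Closure.
End Generated.

Section Smooth.
Variables (R : realType) (n : nat).
Implicit Types (f g : phase R n -> R) (x v : phase R n) (vs : seq (phase R n)).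

(** Smoothness graded by order, in all directions at once. The Leibniz rule turns the derivative of
    a product into products of lower order, so sums and products follow by induction on [k]. *)
Fixpoint diff_upto (k : nat) (f : phase R n -> R) : Prop :=
  (forall x, differentiable f x) /\
  (if k is k'.+1 then forall v, diff_upto k' ('D_v f) else True).

Lemma smoothP f : smooth f <-> forall k, diff_upto k f.
Proof.
split=> [sf k|hf vs].
  elim: k f sf => [|k ih] f sf /=; split=> //; try exact: (sf [::]).
  by move=> v; apply: ih => vs x; exact: (sf (v :: vs)).
elim: vs f hf => [|v vs ih] f hf x /=; first by have [] := hf 0%N.
by apply: ih => k; have [_] := hf k.+1; exact.
Qed.

Lemma diff_uptoS k f : diff_upto k.+1 f -> diff_upto k f.
Proof.
elim: k f => [|k ih] f [df dD]; first by [].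
by split=> // v; apply: ih; exact: dD.
Qed.

Lemma diff_upto_add k f g :
  diff_upto k f -> diff_upto k g -> diff_upto k (fun x => f x + g x).
Proof.
elim: k f g => [|k ih] f g [df Df] [dg Dg]; split=> //.
  by move=> x; exact: differentiableD.
  by move=> x; exact: differentiableD.
move=> v; have -> : 'D_v (fun x => f x + g x) = fun x => 'D_v f x + 'D_v g x.
  by apply/funext => x; rewrite -[LHS]/('D_v (f + g) x) deriveD //; exact: diff_derivable.
exact: (ih _ _ (Df v) (Dg v)).
Qed.

Lemma diff_upto_mul k f g :
  diff_upto k f -> diff_upto k g -> diff_upto k (fun x => f x * g x).
Proof.
elim: k f g => [|k ih] f g Hf Hg; have [df Df] := Hf; have [dg Dg] := Hg; split=> //.
  by move=> x; exact: differentiableM.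
  by move=> x; exact: differentiableM.
move=> v; have -> : 'D_v (fun x => f x * g x) = fun x => f x * 'D_v g x + g x * 'D_v f x.
  by apply/funext => x; rewrite -[LHS]/('D_v (f * g) x) deriveM //; exact: diff_derivable.
by apply: diff_upto_add; [exact: (ih _ _ (diff_uptoS Hf) (Dg v))|
  exact: (ih _ _ (diff_uptoS Hg) (Df v))].
Qed.

Lemma smooth_cst (k : R) : smooth (fun _ : phase R n => k).
Proof.
move=> vs x; elim: vs k => [|v vs ih] k /=; first exact: differentiable_cst.
have -> : 'D_v (fun _ : phase R n => k) = fun=> 0; last exact: ih.
by apply/funext => y; rewrite -[LHS]/('D_v (cst k) y) derive_cst.
Qed.

Lemma smooth_algebra : function_algebra (@smooth R n).
Proof.
split; first exact: smooth_cst.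
- by move=> f g /smoothP sf /smoothP sg; apply/smoothP => k; exact: diff_upto_add.
- by move=> f g /smoothP sf /smoothP sg; apply/smoothP => k; exact: diff_upto_mul.
Qed.

Lemma smooth_differentiable f x : smooth f -> differentiable f x.
Proof. by move=> /(_ [::] x). Qed.

Lemma smooth_coord (i : 'I_n) j : smooth (fun x : phase R n => x i j : R).
Proof.
case=> [|v vs] x /=; first by have [] := coord_diff x i j.
have -> : 'D_v (fun x : phase R n => x i j : R) = fun=> v i j.
  by apply/funext => y; have [dy hy] := coord_diff y i j; rewrite deriveE // hy.
exact: (@smooth_cst _ vs).
Qed.

(** The polynomial functions of the matrix entries. They are smooth, and they restrict to
    one-variable polynomials on lines, which is what makes their non-vanishing loci dense. *)
Definition polyfun : set (phase R n -> R) :=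
  generated_algebra [set f | exists i j, f = fun x : phase R n => x i j : R].

Lemma polyfun_algebra : function_algebra polyfun.
Proof. exact: generated_function_algebra. Qed.

Lemma polyfun_smooth : polyfun `<=` @smooth R n.
Proof.
apply: generated_ind; first exact: smooth_algebra.
by move=> _ [i [j ->]]; exact: smooth_coord.
Qed.

Lemma polyfun_continuous f : polyfun f -> continuous f.
Proof.
move=> /polyfun_smooth sf x.
by apply: differentiable_continuous; exact: smooth_differentiable.
Qed.

Lemma polyfun_coord (i : 'I_n) j : polyfun (fun x : phase R n => x i j : R).
Proof. by apply: sub_generated; exists i, j. Qed.

Lemma polyfun_dot j k : polyfun (fun x : phase R n => dot (col j x) (col k x)).
Proof.
have -> : (fun x : phase R n => dot (col j x) (col k x)) =
    fun x => \sum_i x i j * x i k.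
  by apply/funext => x; rewrite dotE; apply: eq_bigr => i _; rewrite !mxE.
apply: (algebra_sum polyfun_algebra) => i.
by apply: (algebra_mul polyfun_algebra); exact: polyfun_coord.
Qed.

Lemma polyfun_line f x w : polyfun f ->
  exists q : {poly R}, forall t, f (x + t *: w) = q.[t].
Proof.
pose P := [set f : phase R n -> R |
  exists q : {poly R}, forall t, f (x + t *: w) = q.[t]].
apply: (@generated_ind _ _ _ P); first split.
- by move=> k; exists k%:P => t; rewrite hornerC.
- by move=> {}f g [p hp] [q hq]; exists (p + q) => t; rewrite hornerD hp hq.
- by move=> {}f g [p hp] [q hq]; exists (p * q) => t; rewrite hornerM hp hq.
move=> _ [i [j ->]]; exists ((x i j)%:P + (w i j) *: 'X) => t.
by rewrite !mxE hornerD hornerC hornerZ hornerX mulrC.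
Qed.

End Smooth.

Lemma polynomial_small_nonroot (R : realType) (q : {poly R}) (e : R) :
  q != 0 -> 0 < e -> exists2 t, 0 < t < e & q.[t] != 0.
Proof.
move=> q0 e0; apply: contrapT => h.
(* If the claim failed, these [size q] distinct points of the interval would all be roots of [q],
   more than its degree allows. The shift to [k.+2] keeps them strictly below [e]. *)
pose s := [seq e / (k.+2)%:R | k <- iota 0 (size q)].
have : (size s < size q)%N.
  apply: max_poly_roots => //.
    apply/allP => _ /mapP[k _ ->]; apply/rootP/eqP; apply: contrapT => /negP hk.
    apply: h; exists (e / k.+2%:R) => //; rewrite divr_gt0 //=.
    by rewrite ltr_pdivrMr // ltr_pMr // ltr1n.
  rewrite map_inj_uniq ?iota_uniq // => k l /(mulfI (lt0r_neq0 e0)) /invr_inj.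
  by move=> /eqP; rewrite eqr_nat => /eqP[].
by rewrite size_map size_iota ltnn.
Qed.

(** * Brackets and first integrals of a generated algebra *)

Section Span.
Variables (R : realType) (V : vectType R).
Implicit Types (S : set V) (U : {vspace V}).

Lemma is_span_unique S U : is_span S U -> span_set S = U.
Proof.
move=> [SU Umin]; have [SW Wmin] := span_setP S.
by apply: subv_anti; rewrite (Wmin _ SU) (Umin _ SW).
Qed.

Lemma vspace_add U u v : u \in U -> v \in U -> u + v \in U.
Proof. exact: memvD. Qed.

Lemma vspace_scale U k u : u \in U -> k *: u \in U.
Proof. exact: memvZ. Qed.

End Span.

Section Differential.
Variables (R : realType) (n : nat) (eta : R).
Implicit Types (S : set (phase R n -> R)) (f g H : phase R n -> R) (x v : phase R n).

Lemma dfunE f x (v : subvs_of (tangent x)) : dfun f x v = 'd f x (vsval v).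
Proof.
pose l : {linear subvs_of (tangent x) -> R^o} := 'd f x \o vsval.
exact: (lfunE l).
Qed.

Lemma dfun_cst k x : dfun (fun=> k) x = 0.
Proof.
by apply/lfunP => v; rewrite dfunE lfunE -[fun=> k]/(cst k) diff_cst.
Qed.

Lemma dfun_add f g x : smooth f -> smooth g ->
  dfun (fun y => f y + g y) x = dfun f x + dfun g x.
Proof.
move=> /(smooth_differentiable x) df /(smooth_differentiable x) dg.
apply/lfunP => v.
refine (etrans (dfunE _ v) (etrans _ (esym (etrans (add_lfunE _ _ v)
  (f_equal2 +%R (dfunE f v) (dfunE g v)))))).
exact: (congr1 (fun l : phase R n -> R => l (vsval v)) (diffD df dg)).
Qed.

Lemma dfun_mul f g x : smooth f -> smooth g ->
  dfun (fun y => f y * g y) x = f x *: dfun g x + g x *: dfun f x.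
Proof.
move=> /(smooth_differentiable x) df /(smooth_differentiable x) dg.
apply/lfunP => v.
refine (etrans (dfunE _ v) (etrans _ (esym (etrans (add_lfunE _ _ v) (f_equal2 +%R
  (etrans (scale_lfunE _ _ v) (congr1 ( *%R (f x)) (dfunE g v)))
  (etrans (scale_lfunE _ _ v) (congr1 ( *%R (g x)) (dfunE f v)))))))).
exact: (congr1 (fun l : phase R n -> R => l (vsval v)) (diffM df dg)).
Qed.

(** By the sum and Leibniz rules, the differential at [x] of a polynomial in the generators is a
    linear combination of the differentials of the generators. *)
Lemma differentials_generated S x (U : {vspace cotangent x}) :
  S `<=` @smooth R n -> is_span [set dfun f x | f in S] U ->
  differentials (generated_algebra S) x = U.
Proof.
move=> Ssm [SU Umin]; apply: is_span_unique; split; last first.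
  move=> W hW; apply: Umin => _ [f Sf <-]; apply: hW.
  by exists f => //; exact: sub_generated.
move=> _ [f Ff <-].
(* Smoothness is carried through the induction because the sum and product rules for [dfun] need
   it. *)
suff [_] : (smooth f /\ dfun f x \in U) by [].
move: f Ff; apply: generated_ind; last first.
  by move=> f Sf; split; [exact: Ssm|apply: SU; exists f].
split.
- by move=> k; split; [exact: smooth_cst|rewrite dfun_cst mem0v].
- move=> f g [sf hf] [sg hg]; split; first exact: (algebra_add (@smooth_algebra R n)).
  by rewrite dfun_add //; refine (vspace_add hf hg).
- move=> f g [sf hf] [sg hg]; split; first exact: (algebra_mul (@smooth_algebra R n)).
  by rewrite dfun_mul //; refine (vspace_add (vspace_scale _ hg) (vspace_scale _ hf)).
Qed.

Lemma omegaC u v : omega eta u v = - omega eta v u.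
Proof. by rewrite /omega; ring. Qed.

Lemma omegaPl k u u' v : omega eta (k *: u + u') v = k * omega eta u v + omega eta u' v.
Proof. by rewrite /omega e1P e2P p1P p2P !dot_lin; ring. Qed.

Lemma omegaZl k u v : omega eta (k *: u) v = k * omega eta u v.
Proof.
have o0 : omega eta 0 v = 0 by have := omegaPl 1 0 0 v; rewrite scale1r addr0 mul1r; lra.
by rewrite -[k *: u]addr0 omegaPl o0 addr0.
Qed.

Lemma omegaNl u v : omega eta (- u) v = - omega eta u v.
Proof. by rewrite -scaleN1r omegaZl mulN1r. Qed.

Lemma omegaBl u u' v : omega eta (u - u') v = omega eta u v - omega eta u' v.
Proof. by rewrite addrC -scaleN1r omegaPl mulN1r addrC. Qed.

Lemma ham_vector_eq x (a : cotangent x) u : cotangent_bundle x ->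
  u \in tangent x ->
  (forall v : subvs_of (tangent x), omega eta u (vsval v) = - a v) ->
  vsval (ham_vector eta a) = u.
Proof.
move=> Mx Tu h; apply/eqP; rewrite -subr_eq0; apply/eqP.
apply: (@omega_nondegenerate _ _ eta x) => //.
  by rewrite memvB // subvsP.
move=> v Tv; have hv := ham_vectorP eta a (vsproj (tangent x) v) Mx.
by have := h (vsproj (tangent x) v); rewrite -hv vsprojK // omegaBl => ->; rewrite subrr.
Qed.

(** The last hypothesis identifies [u] as the Hamiltonian vector of [g], by nondegeneracy. Brackets
    can thus be computed from an explicit vector, without inverting [flat]. *)
Lemma bracketE f g x u : cotangent_bundle x -> u \in tangent x ->
  (forall v, v \in tangent x -> omega eta u v = - 'd g x v) ->
  bracket eta f g x = 'd f x u.
Proof.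
move=> Mx Tu h; rewrite /bracket /poisson dfunE (ham_vector_eq Mx Tu) // => v.
by rewrite dfunE h ?subvsP.
Qed.

Lemma bracketC f g x : cotangent_bundle x -> bracket eta f g x = - bracket eta g f x.
Proof.
move=> Mx; have h a (v : subvs_of (tangent x)) := ham_vectorP eta a v Mx.
apply: oppr_inj; refine (etrans (esym (h _ _)) (etrans (omegaC _ _) _)).
exact: (congr1 -%R (h _ _)).
Qed.

Lemma bracket_self f x : cotangent_bundle x -> bracket eta f f x = 0.
Proof. by move=> Mx; have := bracketC f f Mx; lra. Qed.

Lemma bracket_cst k g x : bracket eta (fun=> k) g x = 0.
Proof.
have -> : bracket eta (fun=> k) g x = poisson eta (0 : cotangent x) (dfun g x).
  exact: (congr1 (fun a => poisson eta a (dfun g x)) (dfun_cst k x)).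
exact: zero_lfunE.
Qed.

Lemma bracket_add f g h x : smooth f -> smooth g ->
  bracket eta (fun y => f y + g y) h x = bracket eta f h x + bracket eta g h x.
Proof.
move=> sf sg.
refine (etrans (congr1 (fun a => poisson eta a (dfun h x)) (dfun_add x sf sg)) _).
exact: add_lfunE.
Qed.

Lemma bracket_mul f g h x : smooth f -> smooth g ->
  bracket eta (fun y => f y * g y) h x =
  f x * bracket eta g h x + g x * bracket eta f h x.
Proof.
move=> sf sg.
refine (etrans (congr1 (fun a => poisson eta a (dfun h x)) (dfun_mul x sf sg)) _).
refine (etrans (add_lfunE _ _ _) (f_equal2 +%R _ _)); exact: scale_lfunE.
Qed.

(** The bracket is a derivation in its first argument, so closure passes from the generators to the
    algebra. Antisymmetry then gives the same in the second argument. *)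
Lemma generated_bracket_left S g : S `<=` @smooth R n ->
  (forall f, S f -> exists2 h, generated_algebra S h &
     forall x, cotangent_bundle x -> h x = bracket eta f g x) ->
  forall f, generated_algebra S f -> exists2 h, generated_algebra S h &
     forall x, cotangent_bundle x -> h x = bracket eta f g x.
Proof.
move=> Ssm hS; have aF := generated_function_algebra S.
suff P : generated_algebra S `<=` [set f | [/\ smooth f, generated_algebra S f &
    exists2 h, generated_algebra S h &
      forall x, cotangent_bundle x -> h x = bracket eta f g x]].
  by move=> f /P[].
apply: generated_ind; last first.
  by move=> f Sf; split; [exact: Ssm|exact: sub_generated|exact: hS].
split.
- move=> k; split; [exact: smooth_cst|exact: algebra_cst|exists (fun=> 0)].
    exact: algebra_cst.
  by move=> x _; rewrite bracket_cst.
- move=> f1 f2 [s1 F1 [h1 Fh1 e1]] [s2 F2 [h2 Fh2 e2]]; split.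
  + exact: (algebra_add (@smooth_algebra R n)).
  + exact: (algebra_add aF).
  exists (fun x => h1 x + h2 x); first exact: (algebra_add aF).
  by move=> x Mx; rewrite bracket_add // e1 ?e2.
- move=> f1 f2 [s1 F1 [h1 Fh1 e1]] [s2 F2 [h2 Fh2 e2]]; split.
  + exact: (algebra_mul (@smooth_algebra R n)).
  + exact: (algebra_mul aF).
  exists (fun x => f1 x * h2 x + f2 x * h1 x).
    by apply: (algebra_add aF); apply: (algebra_mul aF).
  by move=> x Mx; rewrite bracket_mul // e1 ?e2.
Qed.

Lemma generated_bracket S : S `<=` @smooth R n ->
  (forall f g, S f -> S g -> exists2 h, generated_algebra S h &
     forall x, cotangent_bundle x -> h x = bracket eta f g x) ->
  forall f g, generated_algebra S f -> generated_algebra S g ->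
  exists2 h, generated_algebra S h &
     forall x, cotangent_bundle x -> h x = bracket eta f g x.
Proof.
move=> Ssm hS f g Ff Fg; move: f Ff; apply: generated_bracket_left => // f Sf.
have [|h Fh hE] := @generated_bracket_left S f Ssm _ g Fg.
  by move=> g' Sg'; exact: hS.
exists (fun x => - h x); first exact: (algebra_opp (@generated_function_algebra R n S)).
by move=> x Mx; rewrite hE // bracketC // opprK.
Qed.

Lemma first_integral_algebra H : function_algebra (first_integral eta H).
Proof.
split=> [k|f g hf hg|f g hf hg] a b c tr s t hs ht //.
  by rewrite (hf a b c tr s t) // (hg a b c tr s t).
by rewrite (hf a b c tr s t) // (hg a b c tr s t).
Qed.

(** By the chain rule the derivative of [f] along a trajectory is its bracket with [H], hence zero,
    and the mean value theorem makes [f] constant there. *)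
Lemma first_integral_bracket H f : smooth f ->
  (forall x, cotangent_bundle x -> bracket eta f H x = 0) -> first_integral eta H f.
Proof.
move=> sf fH a b c tr s t hs ht.
have D r : a < r < b -> is_derive r (1 : R) (f \o c) 0.
  move=> /tr[Mr [dc hc]].
  have dc' : differentiable c r by apply/derivable1_diffP.
  have df := smooth_differentiable (c r) sf.
  have dfc : differentiable (f \o c) r by exact: differentiable_comp.
  split; first exact/derivable1_diffP.
  have E : 'd c r 1 = vsval (ham_vector eta (dfun H (c r))) by rewrite -hc deriveE.
  rewrite deriveE // diff_comp //= E.
  by refine (etrans (esym (dfunE _ _)) _); exact: fH.
suff W p q : a < p < b -> a < q < b -> p < q -> f (c p) = f (c q).
  by have [/W|/W h|->] := ltgtP s t; [exact|exact/esym/h|].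
move=> /andP[ap pb] /andP[aq qb] pq.
have inI r : p <= r <= q -> a < r < b.
  by move=> /andP[pr rq]; rewrite (lt_le_trans ap) ?(le_lt_trans rq).
have [r||r rI] := @MVT R (f \o c) (fun=> 0) p q pq.
- by rewrite in_itv /= => /andP[/ltW h1 /ltW h2]; apply/D/inI/andP.
- apply: derivable_within_continuous => r; rewrite in_itv /= => /inI hr.
  by have [] := D r hr.
- by move/eqP; rewrite mul0r subr_eq0 => /eqP.
Qed.

End Differential.

(** * Coisotropic subspaces *)

Section LinearAlgebra.
Variable R : realType.

Lemma linear_lfunE (aT rT : vectType R) (f : aT -> rT) :
  linear f -> forall v, linfun f v = f v.
Proof.
move=> lf v; pose m := GRing.isLinear.Build R aT rT _ f lf.
by pose l : {linear aT -> rT} := HB.pack f m; exact: (lfunE l).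
Qed.

(** Restriction of linear forms from V to W is onto the dual of W, and [N] lies in its kernel;
    rank-nullity gives the bound. *)
Lemma annihilator_dim (V : vectType R) (W : {vspace V}) (N : {vspace 'Hom(V, R^o)}) :
  (forall a u, a \in N -> u \in W -> a u = 0) -> (\dim N + \dim W <= \dim {:V})%N.
Proof.
move=> NW.
pose L := linfun (fun a : 'Hom(V, R^o) =>
  (a \o linfun (vsval : subvs_of W -> V))%VF).
have LE a : L a = (a \o linfun vsval)%VF.
  by apply: linear_lfunE => k b c; rewrite comp_lfunDl comp_lfunZl.
have L_full : limg L = fullv.
  apply/eqP; rewrite eqEsubv subvf /=; apply/subvP => b _.
  (* A form on W is extended to V by precomposing with the projection onto W. *)
  apply/memv_imgP; exists (b \o linfun (vsproj W))%VF; first exact: memvf.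
  rewrite LE; apply/lfunP => v; rewrite !comp_lfunE !lfunE /=.
  by rewrite vsvalK.
have NL : (N <= lker L)%VS.
  apply/subvP => a Na; rewrite memv_ker LE; apply/eqP/lfunP => v.
  rewrite comp_lfunE !lfunE /=; apply: NW => //; exact: subvsP.
have := limg_ker_dim L fullv; rewrite capfv L_full.
have dimH (V' : vectType R) : \dim {: 'Hom(V', R^o)} = \dim {: V'}.
  by rewrite !dimvf /dim /= muln1.
rewrite !dimH => <-; apply: leq_add; first exact: dimvS.
by rewrite [in leqRHS]dimvf.
Qed.

Lemma dim_add_line (V : vectType R) (W : {vspace V}) v :
  v \notin W -> \dim (W + <[v]>)%VS = (\dim W).+1.
Proof.
move=> Wv; have v0 : v != 0 by apply: contraNneq Wv => ->; rewrite mem0v.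
rewrite dimv_disjoint_sum ?dim_vline ?v0 ?addn1 //.
apply/eqP; rewrite -subv0; apply/subvP => u /memv_capP[Wu /vlineP[k uE]].
move: Wu; rewrite uE memv0; have [->|k0] := eqVneq k 0; first by rewrite scale0r.
by move=> /(memvZ k^-1); rewrite scalerA mulVf // scale1r (negbTE Wv).
Qed.

End LinearAlgebra.

Section Symplectic.
Variables (R : realType) (n : nat) (eta : R) (x : phase R n).
Hypothesis Mx : cotangent_bundle x.
Implicit Types (u v w : phase R n) (W N : {vspace phase R n}).

(** [flat] precomposed with the projection onto the tangent space, so that it applies to subspaces
    of the ambient matrix space; it is only evaluated meaningfully on tangent vectors. *)
Definition flatT : 'Hom(phase R n, cotangent x) :=
  (flat eta x \o linfun (vsproj (tangent x)))%VF.

Lemma flatTE u (v : subvs_of (tangent x)) : u \in tangent x ->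
  flatT u v = omega eta u (vsval v).
Proof.
move=> Tu; have E : flatT u = flat eta x (vsproj (tangent x) u).
  by rewrite /flatT comp_lfunE lfunE.
refine (etrans (congr1 (fun a : cotangent x => a v) E) (etrans (flatE _ _ _) _)).
by rewrite vsprojK.
Qed.

Lemma flatT_inj W : (W <= tangent x)%VS -> (W :&: lker flatT)%VS = 0%VS.
Proof.
move=> /subvP WT; apply/eqP; rewrite -subv0; apply/subvP => u /memv_capP[/WT Tu].
rewrite memv_ker memv0 => /eqP u0; apply/eqP.
apply: (@omega_nondegenerate _ _ eta x) => // v Tv.
rewrite -(vsprojK Tv) -flatTE //.
refine (etrans (congr1 (fun a : cotangent x => a _) u0) _); exact: zero_lfunE.
Qed.

Lemma ham_flatT u : u \in tangent x -> vsval (ham_vector eta (flatT u)) = - u.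
Proof.
move=> Tu; apply: ham_vector_eq => //; first by rewrite memvN.
move=> v; refine (etrans _ (congr1 -%R (esym (flatTE v Tu)))).
exact: omegaNl.
Qed.

Lemma flatT_ham (a : cotangent x) : a = flatT (- vsval (ham_vector eta a)).
Proof.
apply/lfunP => v; apply/esym; refine (etrans (flatTE _ _) _).
  by rewrite memvN subvsP.
rewrite omegaNl; apply: oppr_inj; rewrite opprK; exact: ham_vectorP.
Qed.

Lemma poisson_flatT u w : u \in tangent x -> w \in tangent x ->
  poisson eta (flatT u) (flatT w) = omega eta w u.
Proof.
move=> Tu Tw; refine (etrans (flatTE _ Tu) _); rewrite ham_flatT //.
by rewrite omegaC omegaNl opprK.
Qed.

(** Under [flatT], which is injective on W, the Poisson kernel of the image contains the image of
    [N] and annihilates W. So its dimension is at least that of [N] and at most the codimension of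
    W, and the dimension hypothesis makes the two bounds equal. *)
Lemma coisotropic_dim W N : (W <= tangent x)%VS -> (N <= W)%VS ->
  (forall u w, u \in N -> w \in W -> omega eta u w = 0) ->
  (\dim W + \dim N)%N = \dim (tangent x) ->
  \dim (flatT @: W) = \dim W /\
  (\dim (flatT @: W) + \dim (poisson_kernel eta (flatT @: W)))%N = \dim (tangent x).
Proof.
move=> WT NW NW0 dimE; have dimW : \dim (flatT @: W) = \dim W.
  by apply: limg_dim_eq; exact: flatT_inj.
split=> //; rewrite dimW -dimE; congr addn.
have WTP := subvP WT; have NWP := subvP NW.
set K := poisson_kernel _ _.
have [KS Kmin] := span_setP [set a | a \in (flatT @: W)%VS /\
  forall b, b \in (flatT @: W)%VS -> poisson eta a b = 0].
apply/eqP; rewrite eqn_leq; apply/andP; split; last first.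
  rewrite -(@limg_dim_eq _ _ _ flatT N); last exact/flatT_inj/(subv_trans NW).
  apply: dimvS; apply/subvP => _ /memv_imgP[u Nu ->]; apply: KS; split.
    exact/memv_img/NWP.
  move=> _ /memv_imgP[w Ww ->].
  refine (etrans (poisson_flatT (WTP _ (NWP _ Nu)) (WTP _ Ww)) _).
  by rewrite omegaC (NW0 _ _ Nu Ww) oppr0.
pose W' := (linfun (vsproj (tangent x)) @: W)%VS.
have dimW' : \dim W' = \dim W.
  apply: limg_dim_eq; apply/eqP; rewrite -subv0; apply/subvP => u /memv_capP[/WTP Tu].
  by rewrite memv_ker lfunE memv0 /= => /eqP u0; rewrite -(vsprojK Tu) u0.
have KW (a : cotangent x) (u : subvs_of (tangent x)) : a \in K -> u \in W' -> a u = 0.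
  move=> Ka /memv_imgP[w Ww ->]; rewrite lfunE /=.
  pose ann : {vspace cotangent x} :=
    lker (linfun (fun a : cotangent x => a (vsproj (tangent x) w) : R^o)).
  have annE b : (b \in ann) = (b (vsproj (tangent x) w) == 0).
    rewrite memv_ker linear_lfunE // => k c d.
    by refine (etrans (add_lfunE _ _ _) _); rewrite scale_lfunE.
  apply/eqP; rewrite -annE; apply: (subvP (Kmin ann _)) => // b [Wb].
  have Tw := WTP _ Ww.
  move=> /(_ (flatT w) (memv_img _ Ww)) b0.
  (* The Hamiltonian vector of [flatT w] is [- w], so a covector that Poisson-commutes with
     [flatT w] vanishes on [w]. *)
  have E : vsproj (tangent x) w = - ham_vector eta (flatT w).
    apply: val_inj; refine (etrans (vsprojK Tw) _).
    exact: (etrans (esym (opprK w)) (congr1 -%R (esym (ham_flatT Tw)))).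
  rewrite annE; apply/eqP; refine (etrans (congr1 b E) (etrans (linearN b _) _)).
  exact: (etrans (congr1 -%R b0) (oppr0 _)).
have := annihilator_dim KW; rewrite dimW' addnC.
have -> : \dim {: subvs_of (tangent x)} = \dim (tangent x) by rewrite dimvf.
by rewrite -dimE leq_add2l.
Qed.

End Symplectic.

(** * Infinitesimal rotations and the momentum map *)

Section IsDiff.
Variables (R : realType) (n : nat) (x : phase R n).
Implicit Types f g df dg : phase R n -> R.

Lemma is_diff_addf f g df dg : is_diff x f df -> is_diff x g dg ->
  is_diff x (fun y => f y + g y) (fun v => df v + dg v).
Proof. by move=> hf hg; exact: is_diffD. Qed.

Lemma is_diff_subf f g df dg : is_diff x f df -> is_diff x g dg ->
  is_diff x (fun y => f y - g y) (fun v => df v - dg v).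
Proof. by move=> hf hg; exact: is_diffB. Qed.

Lemma is_diff_scalef k f df : is_diff x f df ->
  is_diff x (fun y => k * f y) (fun v => k * df v).
Proof. by move=> hf; exact: is_diffZ. Qed.

Lemma is_diff_mulf f g df dg : is_diff x f df -> is_diff x g dg ->
  is_diff x (fun y => f y * g y) (fun v => f x * dg v + g x * df v).
Proof. by move=> hf hg; exact: is_diffM. Qed.

Lemma is_diffE f df v : is_diff x f df -> 'd f x v = df v.
Proof. by move=> [_ ->]. Qed.

Lemma is_diff_ext f g df dg : is_diff x f df -> f =1 g -> df =1 dg -> is_diff x g dg.
Proof. by move=> h /funext <- /funext <-. Qed.

End IsDiff.

Section Rotation.
Variables (R : realType) (n : nat) (eta : R).
Implicit Types (x u v w : phase R n) (a b : 'cV[R]_n) (B C : 'M[R]_n).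

Lemma e1M C x : e1 (C *m x) = C *m e1 x.
Proof. by rewrite !e1E !colE mulmxA. Qed.
Lemma e2M C x : e2 (C *m x) = C *m e2 x.
Proof. by rewrite !e2E !colE mulmxA. Qed.
Lemma p1M C x : p1 (C *m x) = C *m p1 x.
Proof. by rewrite !p1E !colE mulmxA. Qed.
Lemma p2M C x : p2 (C *m x) = C *m p2 x.
Proof. by rewrite !p2E !colE mulmxA. Qed.

Lemma dot_tr a b : dot a b = \tr (a *m b^T).
Proof.
rewrite dotE /mxtrace; apply: eq_bigr => i _.
by rewrite !mxE big_ord1 !mxE.
Qed.

Lemma dot_mul_tr C a b : dot (C *m a) b = \tr (C *m (a *m b^T)).
Proof. by rewrite dot_tr mulmxA. Qed.

Lemma dot_skewr C a b : C^T = - C -> dot a (C *m b) = - dot (C *m a) b.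
Proof.
move=> hC; have -> : dot (C *m a) b = (- (a^T *m (C *m b))) 0 0.
  by rewrite /dot trmx_mul hC mulmxN mulNmx mulmxA.
by rewrite mxE opprK.
Qed.

Lemma dot_skew C a : C^T = - C -> dot a (C *m a) = 0.
Proof. by move=> hC; have := dot_skewr a a hC; rewrite (dotC (C *m a)); lra. Qed.

Lemma mxtrace_skew C B : C^T = - C -> \tr (C *m B^T) = - \tr (C *m B).
Proof.
move=> hC; rewrite -(mxtrace_tr (C *m B^T)) trmx_mul trmxK hC mulmxN linearN /=.
by rewrite mxtrace_mulC.
Qed.

Lemma rotation_tangent x C : C^T = - C -> C *m x \in tangent x.
Proof.
move=> hC; apply/tangentP; rewrite e1M e2M p1M p2M !(dot_skew _ hC).
have h a b : dot a (C *m b) + dot b (C *m a) = 0.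
  by rewrite (dot_skewr a) // (dotC _ b) addNr.
by split; [split|..]; rewrite ?h ?addr0.
Qed.

(** A bilinear form whose antisymmetrized diagonal is [Phi]; polarizing it yields the differential
    [Phi_diff] of [Phi]. *)
Definition Phi_half u v : 'M[R]_n :=
  p1 u *m (e1 v)^T + p2 u *m (e2 v)^T + eta *: (e1 u *m (e2 v)^T).

Lemma Phi_halfE x : Phi eta x = Phi_half x x - (Phi_half x x)^T.
Proof.
rewrite /Phi /Phi_half /wedge !linearD /= !linearZ /= !trmx_mul !trmxK.
by apply/matrixP => i j; rewrite !mxE; ring.
Qed.

Definition Phi_diff x v : 'M[R]_n :=
  (Phi_half x v + Phi_half v x) - (Phi_half x v + Phi_half v x)^T.

Lemma Phi_skew x : (Phi eta x)^T = - Phi eta x.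
Proof. by rewrite Phi_halfE linearB /= trmxK opprB. Qed.

Lemma Phi_antisym x i j : Phi eta x j i = - Phi eta x i j.
Proof.
move: (Phi eta x) (Phi_skew x) => M /matrixP/(_ i j).
by rewrite [LHS]mxE [RHS]mxE.
Qed.

Lemma Phi_coordE i j x : Phi_coord eta i j x = Phi eta x i j.
Proof.
rewrite /Phi_coord /so_dot /wedge /std_basis mulmxBr linearB /=.
rewrite !trmx_delta !mul_delta_mx.
have E k l : \tr (Phi eta x *m delta_mx k l) = Phi eta x l k.
  rewrite mxtrace_mulC /mxtrace (bigD1 k) //= big1 ?addr0.
    rewrite mxE (bigD1 l) //= big1 ?addr0; first by rewrite !mxE !eqxx mul1r.
    by move=> m /negbTE ml; rewrite mxE eqxx ml mul0r.
  move=> m /negbTE mk; rewrite mxE big1 // => m' _.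
  by rewrite mxE mk mul0r.
rewrite !E; by rewrite (Phi_antisym _ i j); field.
Qed.

Lemma Phi_half_diff x i j :
  is_diff x (fun y => Phi_half y y i j : R)
    (fun v => (Phi_half x v + Phi_half v x) i j).
Proof.
have Q k l := is_diff_mulf (coord_diff x i k) (coord_diff x j l).
have E u v : Phi_half u v i j =
    u i (rshift 2 0) * v j (lshift 2 0) + u i (rshift 2 1) * v j (lshift 2 1)
    + eta * (u i (lshift 2 0) * v j (lshift 2 1)).
  by rewrite /Phi_half p1E p2E !e1E !e2E !mxE !big_ord1 !mxE.
have h := is_diff_addf (is_diff_addf (Q (rshift 2 0) (lshift 2 0))
  (Q (rshift 2 1) (lshift 2 1))) (is_diff_scalef eta (Q (lshift 2 0) (lshift 2 1))).
apply: (is_diff_ext h) => v; first by rewrite E.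
by rewrite [RHS]mxE !E; ring.
Qed.

Lemma Phi_coord_diff x v i j : 'd (Phi_coord eta i j) x v = Phi_diff x v i j.
Proof.
apply: (@is_diffE _ _ _ _ (fun v => Phi_diff x v i j)).
apply: (is_diff_ext (is_diff_subf (Phi_half_diff x i j) (Phi_half_diff x j i))) => y.
  by rewrite Phi_coordE Phi_halfE !mxE.
by rewrite /Phi_diff !mxE.
Qed.

Lemma polyfun_Phi_coord (i j : 'I_n) : polyfun (Phi_coord eta i j).
Proof.
have -> : Phi_coord eta i j = fun y : phase R n =>
    y i (rshift 2 0) * y j (lshift 2 0) + y i (rshift 2 1) * y j (lshift 2 1)
    + eta * (y i (lshift 2 0) * y j (lshift 2 1))
    - (y j (rshift 2 0) * y i (lshift 2 0) + y j (rshift 2 1) * y i (lshift 2 1)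
    + eta * (y j (lshift 2 0) * y i (lshift 2 1))).
  apply/funext => y; rewrite Phi_coordE Phi_halfE !mxE !big_ord1 p1E p2E !e1E !e2E.
  by rewrite !mxE.
have aP := @polyfun_algebra R n.
have cP i' j' := @polyfun_coord R n i' j'.
by do ?[exact: cP|apply: (algebra_sub aP)|apply: (algebra_add aP)
  |apply: (algebra_scale aP)|apply: (algebra_mul aP)].
Qed.

Lemma omega_rotation x v C : C^T = - C ->
  omega eta (C *m x) v = \tr (C *m (Phi_half x v + Phi_half v x)).
Proof.
move=> hC; rewrite /omega e1M e2M p1M p2M !(dot_skewr _ _ hC) !dot_mul_tr /Phi_half.
rewrite !(mulmxDr, mulmxBr) -!scalemxAr !linearD /= !linearZ /=; ring.
Qed.

(** This is the momentum map property: in terms of the product on so(n), the right side is minus the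
    pairing of C with the derivative of [Phi], so C x is the Hamiltonian vector of that
    component. *)
Lemma omega_rotation_Phi x v C : C^T = - C ->
  omega eta (C *m x) v = 1 / 2 * \tr (C *m Phi_diff x v).
Proof.
move=> hC; rewrite omega_rotation // /Phi_diff mulmxBr linearB /= mxtrace_skew //.
by field.
Qed.

(** Infinitesimal equivariance: rotating [x] conjugates [Phi], whose derivative is the commutator
    with C. *)
Lemma Phi_diff_rotation x C : C^T = - C ->
  Phi_diff x (C *m x) = C *m Phi eta x - Phi eta x *m C.
Proof.
move=> hC; rewrite /Phi_diff; have -> : Phi_half x (C *m x) + Phi_half (C *m x) x =
    C *m Phi_half x x - Phi_half x x *m C.
  rewrite /Phi_half e1M e2M p1M p2M !trmx_mul hC !mulmxN !(mulmxDr, mulmxDl).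
  rewrite -!(scalemxAl, scalemxAr) !scalerN !mulmxA addrC !opprD.
  by congr (_ + _ + _ + _).
rewrite Phi_halfE mulmxBr mulmxBl linearB /= !trmx_mul hC mulmxN mulNmx.
move: (C *m Phi_half x x) (Phi_half x x *m C) (_^T *m C) (C *m _^T) => X1 X2 X3 X4.
by apply/matrixP => i j; rewrite !mxE; ring.
Qed.

(** The value is half the trace of C [B, Phi], which vanishes by cyclicity once C commutes with
    Phi. *)
Lemma omega_rotation_rotation x C B : C^T = - C -> B^T = - B ->
  C *m Phi eta x = Phi eta x *m C -> omega eta (C *m x) (B *m x) = 0.
Proof.
move=> hC hB CPhi; rewrite omega_rotation_Phi // Phi_diff_rotation //.
rewrite mulmxBr linearB /= !mulmxA CPhi -[Phi eta x *m C *m B]mulmxA.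
by rewrite [X in _ - X]mxtrace_mulC subrr mulr0.
Qed.

Lemma rotation_generatorE i j :
  wedge (std_basis R i) (std_basis R j) = delta_mx i j - delta_mx j i :> 'M[R]_n.
Proof. by rewrite /wedge /std_basis !trmx_delta !mul_delta_mx. Qed.

Lemma rotation_generator_skew i j :
  (wedge (std_basis R i) (std_basis R j))^T =
    - wedge (std_basis R i) (std_basis R j) :> 'M[R]_n.
Proof. by rewrite rotation_generatorE linearB /= !trmx_delta opprB. Qed.

Lemma omega_Phi_coord x v i j :
  omega eta (wedge (std_basis R i) (std_basis R j) *m x) v = - 'd (Phi_coord eta i j) x v.
Proof.
rewrite omega_rotation_Phi ?rotation_generator_skew // Phi_coord_diff.
rewrite rotation_generatorE mulmxBl linearB /=.
have E k l (M : 'M[R]_n) : \tr (delta_mx k l *m M) = M l k.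
  rewrite /mxtrace (bigD1 k) //= big1 ?addr0.
    rewrite mxE (bigD1 l) //= big1 ?addr0; first by rewrite !mxE !eqxx mul1r.
    by move=> m /negbTE ml; rewrite mxE eqxx ml mul0r.
  move=> m /negbTE mk; rewrite mxE big1 // => m' _.
  by rewrite mxE mk mul0r.
rewrite !E /Phi_diff; move: (Phi_half x v + Phi_half v x) => M.
by rewrite !mxE; field.
Qed.

(** Antisymmetrizing an arbitrary matrix parametrizes so(n) linearly, so the tangent space of the
    rotation orbit is the image of a full matrix space. *)
Definition so_orbit x : {vspace phase R n} :=
  limg (linfun (fun B : 'M[R]_n => (B - B^T) *m x)).

Lemma so_orbitE x B : linfun (fun B : 'M[R]_n => (B - B^T) *m x) B = (B - B^T) *m x.
Proof.
rewrite linear_lfunE // => k B1 B2.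
by rewrite linearP /= opprD addrACA -scalerBr mulmxDl scalemxAl.
Qed.

Lemma so_orbitP x v : reflect (exists2 C, C^T = - C & v = C *m x) (v \in so_orbit x).
Proof.
apply: (iffP memv_imgP) => [[B _ ->]|[C hC ->]].
  exists (B - B^T); last by rewrite so_orbitE.
  by rewrite linearB /= trmxK opprB.
(* The half compensates for C - C^T = 2 C when C is skew. *)
exists (2^-1 *: C); rewrite ?memvf // so_orbitE linearZ /= hC scalerN opprK.
by congr (_ *m x); apply/matrixP => i j; rewrite !mxE; field.
Qed.

Lemma so_orbit_tangent x : (so_orbit x <= tangent x)%VS.
Proof. by apply/subvP => _ /so_orbitP[C hC ->]; exact: rotation_tangent. Qed.

Lemma Phi_coord_bracket x H i j : cotangent_bundle x ->
  (forall C, C^T = - C -> 'd H x (C *m x) = 0) ->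
  bracket eta (Phi_coord eta i j) H x = 0.
Proof.
move=> Mx inv; pose A : 'M[R]_n := wedge (std_basis R i) (std_basis R j).
rewrite bracketC // (@bracketE _ _ _ _ _ _ (A *m x)) //.
- by rewrite inv ?oppr0 // rotation_generator_skew.
- by apply: rotation_tangent; exact: rotation_generator_skew.
- by move=> v _; exact: omega_Phi_coord.
Qed.

(** The bracket is an entry of a commutator of [Phi] with a constant matrix, hence linear in the
    entries of [Phi]. The entries on and below the diagonal come from those above it by
    antisymmetry. *)
Lemma Phi_coord_closed (F : set (phase R n -> R)) : function_algebra F ->
  (forall i j : 'I_n, (i < j)%N -> F (Phi_coord eta i j)) ->
  forall i j k l : 'I_n, exists2 h, F h & forall x, cotangent_bundle x ->
    h x = bracket eta (Phi_coord eta i j) (Phi_coord eta k l) x.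
Proof.
move=> aF FPhi i j k l.
have FP (a b : 'I_n) : F (fun x => Phi eta x a b).
  have [ab|ab|ab] := ltngtP a b.
  - by rewrite (_ : (fun x => _) = Phi_coord eta a b); [exact: FPhi|
      apply/funext => x; rewrite Phi_coordE].
  - rewrite (_ : (fun x => _) = fun x => - Phi_coord eta b a x); last first.
      by apply/funext => x; rewrite Phi_coordE (Phi_antisym _ b a).
    exact/(algebra_opp aF)/FPhi.
  - rewrite (_ : (fun x => _) = fun=> 0); first exact: algebra_cst.
    by apply/funext => x; have := Phi_antisym x a b; rewrite (val_inj ab); lra.
pose C : 'M[R]_n := wedge (std_basis R k) (std_basis R l).
exists (fun x => \sum_m C i m * Phi eta x m j - \sum_m Phi eta x i m * C m j).
  apply: (algebra_sub aF); apply: (algebra_sum aF) => m; apply: (algebra_mul aF);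
    by [exact: FP|exact: algebra_cst].
move=> x Mx; have hC : C^T = - C by exact: rotation_generator_skew.
rewrite (@bracketE _ _ _ _ _ _ (C *m x)) //.
- by rewrite Phi_coord_diff Phi_diff_rotation // !mxE.
- exact: rotation_tangent.
- by move=> v _; exact: omega_Phi_coord.
Qed.

Lemma differentials_generators x H : cotangent_bundle x -> smooth H ->
  is_span [set dfun f x | f in integral_generators eta H]
    (flatT eta x @: (so_orbit x + <[vsval (ham_vector eta (dfun H x))]>))%VS.
Proof.
move=> Mx sH; set XH := vsval _.
pose A i j : 'M[R]_n := wedge (std_basis R i) (std_basis R j).
have AT i j : A i j *m x \in tangent x.
  by apply: rotation_tangent; exact: rotation_generator_skew.
have PhiE i j : dfun (Phi_coord eta i j) x = flatT eta x (- (A i j *m x)).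
  apply/lfunP => v; refine (etrans (dfunE _ _) (esym (etrans (flatTE _ _ _) _))).
    by rewrite memvN.
  by rewrite omegaNl omega_Phi_coord opprK.
have HE : dfun H x = flatT eta x (- XH) by exact: flatT_ham.
split.
  move=> _ [f [[i [j [_ ->]]]|->] <-]; rewrite ?PhiE ?HE; apply: memv_img; rewrite memvN.
    apply: (subvP (addvSl _ _)); apply/so_orbitP; exists (A i j) => //.
    exact: rotation_generator_skew.
  by apply: (subvP (addvSr _ _)); exact: memv_line.
(* For minimality, the preimage of W is shown to contain the Hamiltonian vectors of all generators;
   elementary rotations span [so_orbit x]. *)
move=> W hW; pose P := (flatT eta x @^-1: W)%VS.
suff /subvP UP : (so_orbit x + <[XH]> <= P)%VS.
  by apply/subvP => a /memv_imgP[u /UP]; rewrite -memv_preim => Wu ->.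
rewrite subv_add; apply/andP; split; last first.
  rewrite -memvE -memvN -memv_preim -HE; apply: hW; exists H => //; by right.
have PA i j : A i j *m x \in P.
  have lt (k l : 'I_n) : (k < l)%N -> A k l *m x \in P.
    move=> kl; rewrite -memvN -memv_preim -PhiE; apply: hW.
    by exists (Phi_coord eta k l) => //; left; exists k, l.
  have [/lt//|/lt h|/val_inj ->] := ltngtP i j.
    have -> : A i j = - A j i by rewrite /A !rotation_generatorE opprB.
    by rewrite mulNmx memvN.
  by rewrite /A rotation_generatorE subrr mul0mx mem0v.
apply/subvP => u /memv_imgP[B _ ->]; rewrite (matrix_sum_delta B) linear_sum.
apply: memv_suml => i _; rewrite linear_sum; apply: memv_suml => j _.
rewrite linearZ /=; apply: memvZ; have E := so_orbitE x (delta_mx i j).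
rewrite trmx_delta -rotation_generatorE in E; rewrite E; exact: PA.
Qed.

End Rotation.

(** * Codimension of the orbits *)

Section Frame.
Variables (R : realType) (n : nat).

Lemma dual_frame k (Y : 'M[R]_(n, k)) :
  (forall c : 'cV_k, Y *m c = 0 -> c = 0) -> exists P : 'M[R]_(n, k), Y^T *m P = 1%:M.
Proof.
move=> Yfree; apply/row_freeP; apply: inj_row_free => c cY.
rewrite -[c]trmxK (Yfree c^T) ?trmx0 //.
by rewrite -[Y]trmxK -trmx_mul cY trmx0.
Qed.

(** The columns of P are dual to those of Y, so v P^T already maps Y to v. Subtracting its transpose
    makes it skew, and the third term, skew by the Gram condition, cancels the error this causes on
    Y. *)
Lemma rotation_extension k (Y v P : 'M[R]_(n, k)) :
  Y^T *m P = 1%:M -> (Y^T *m v)^T = - (Y^T *m v) ->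
  exists2 C : 'M[R]_n, C^T = - C & C *m Y = v.
Proof.
move=> YP K; have PY : P^T *m Y = 1%:M by rewrite -[Y]trmxK -trmx_mul YP trmx1.
have vY : v^T *m Y = - (Y^T *m v) by rewrite -[v^T *m Y]trmxK trmx_mul trmxK.
exists (v *m P^T - P *m v^T - P *m (Y^T *m v) *m P^T).
  have tB (M N : 'M[R]_n) : (M - N)^T = M^T - N^T by exact: linearB.
  rewrite !tB !trmx_mul !trmxK vY mulNmx mulmxN -!mulmxA.
  move: (v *m P^T) (P *m v^T) (P *m _) => X1 X2 X3.
  by apply/matrixP => i j; rewrite !mxE; ring.
rewrite !mulmxBl -!mulmxA PY !mulmx1 vY mulmxN.
by apply/matrixP => i j; rewrite !mxE; ring.
Qed.

End Frame.

Section Orbit.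
Variables (R : realType) (n : nat).
Implicit Types (x u v w : phase R n) (C : 'M[R]_n).

Lemma ord2P (j : 'I_2) : j = 0 \/ j = 1.
Proof. by case: j => [[|[|]]] // ?; [left|right]; apply: val_inj. Qed.

Lemma ord4_ind (P : 'I_(2 + 2) -> Prop) :
  P (lshift 2 0) -> P (lshift 2 1) -> P (rshift 2 0) -> P (rshift 2 1) -> forall i, P i.
Proof.
by move=> h1 h2 h3 h4 i; case: (split_ordP i) => j ->; have [->|->] := ord2P j.
Qed.

Lemma mul_cV4 x (c : 'cV[R]_(2 + 2)) : x *m c =
  c (lshift 2 0) 0 *: e1 x + c (lshift 2 1) 0 *: e2 x
  + (c (rshift 2 0) 0 *: p1 x + c (rshift 2 1) 0 *: p2 x).
Proof.
rewrite e1E e2E p1E p2E; apply/matrixP => i j; rewrite ord1 !mxE big_split_ord /=.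
rewrite !big_ord_recl !big_ord0.
have -> : lift ord0 ord0 = 1 :> 'I_2 by apply: val_inj.
have -> : ord0 = 0 :> 'I_2 by [].
by ring.
Qed.

Lemma cotangent_dots x : cotangent_bundle x ->
  ((dot (e1 x) (e1 x) = 1) * (dot (e2 x) (e2 x) = 1) *
   (dot (e1 x) (e2 x) = 0) * (dot (e2 x) (e1 x) = 0) *
   (dot (e1 x) (p1 x) = 0) * (dot (p1 x) (e1 x) = 0) *
   (dot (e2 x) (p2 x) = 0) * (dot (p2 x) (e2 x) = 0) *
   (dot (e1 x) (p2 x) = - dot (p1 x) (e2 x)) *
   (dot (p2 x) (e1 x) = - dot (p1 x) (e2 x)) *
   (dot (e2 x) (p1 x) = dot (p1 x) (e2 x)) *
   (dot (p2 x) (p1 x) = dot (p1 x) (p2 x)))%type.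
Proof.
move=> [[h11 h22 h12] k1 k2 k12]; rewrite -/(e1 x) -/(e2 x) in h11 h22 h12.
rewrite (dotC (p1 x) (e1 x)) (dotC (p2 x) (e2 x)) (dotC (p2 x) (e1 x)).
rewrite (dotC (p1 x) (e2 x)) (dotC (e2 x) (e1 x)) (dotC (p2 x) (p1 x)).
by do !split=> //; lra.
Qed.

(** The Gram determinant of the components of p1 and p2 orthogonal to e1 and e2. On the cotangent
    bundle it equals that of the four vectors, since e1 and e2 are orthonormal. *)
Definition gram_det x : R :=
  (dot (p1 x) (p1 x) - dot (p1 x) (e2 x) ^+ 2) *
  (dot (p2 x) (p2 x) - dot (p1 x) (e2 x) ^+ 2) - dot (p1 x) (p2 x) ^+ 2.

Lemma frame4 x : cotangent_bundle x -> gram_det x != 0 ->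
  exists P : 'M[R]_(n, 2 + 2), x^T *m P = 1%:M.
Proof.
move=> Mx D; have E := cotangent_dots Mx; apply: dual_frame => c xc0.
move: xc0; rewrite mul_cV4.
set c1 := c _ 0; set c2 := c _ 0; set c3 := c _ 0; set c4 := c _ 0 => h.
have dh a : dot a (c1 *: e1 x + c2 *: e2 x + (c3 *: p1 x + c4 *: p2 x)) = 0.
  by rewrite h dot0r.
have h1 := dh (e1 x); have h2 := dh (e2 x); have h3 := dh (p1 x); have h4 := dh (p2 x).
rewrite !dot_lin !E in h1 h2 h3 h4.
move: D h1 h2 h3 h4; rewrite /gram_det.
set m := dot (p1 x) (e2 x); set A := dot (p1 x) (p1 x); set B := dot (p2 x) (p2 x).
set C := dot (p1 x) (p2 x) => D h1 h2 h3 h4.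
have c1E : c1 = m * c4 by lra.
have c2E : c2 = - (m * c3) by lra.
have g3 : (A - m ^+ 2) * c3 + C * c4 = 0 by rewrite -h3 c2E; ring.
have g4 : C * c3 + (B - m ^+ 2) * c4 = 0 by rewrite -h4 c1E; ring.
(* Pairing the relation with the four vectors and eliminating [c1] and [c2] leaves the system [g3],
   [g4] of determinant [gram_det x], solved by Cramer's rule. *)
have c3_0 : c3 = 0.
  apply: (mulfI D); rewrite mulr0; transitivity ((B - m ^+ 2) *
    ((A - m ^+ 2) * c3 + C * c4) - C * (C * c3 + (B - m ^+ 2) * c4)); first by ring.
  by rewrite g3 g4 !mulr0 subrr.
have c4_0 : c4 = 0.
  apply: (mulfI D); rewrite mulr0; transitivity ((A - m ^+ 2) *
    (C * c3 + (B - m ^+ 2) * c4) - C * ((A - m ^+ 2) * c3 + C * c4)); first by ring.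
  by rewrite g3 g4 !mulr0 subrr.
apply/matrixP => i j; rewrite ord1 mxE; move: i.
by apply: ord4_ind; rewrite -/c1 -/c2 -/c3 -/c4 ?c1E ?c2E ?c3_0 ?c4_0 ?mulr0 ?oppr0.
Qed.

(** Four vectors are always dependent in dimension 3, so there the frame (e1, e2, p1) replaces the
    whole of [x]. *)
Definition frame3 x : 'M[R]_(n, 2 + 1) := row_mx (base x) (p1 x).

(** If p1 had no component orthogonal to e1 and e2, it would be a multiple of e2, and its product
    with p2 would vanish. *)
Lemma frame3P x : cotangent_bundle x -> dot (p1 x) (p2 x) != 0 ->
  exists P : 'M[R]_(n, 2 + 1), (frame3 x)^T *m P = 1%:M.
Proof.
move=> Mx D; have E := cotangent_dots Mx; apply: dual_frame => c xc0.
pose c1 := c (lshift 1 0) 0; pose c2 := c (lshift 1 1) 0; pose c3 := c (rshift 2 0) 0.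
have h : c1 *: e1 x + c2 *: e2 x + c3 *: p1 x = 0.
  rewrite -xc0 -[c]vsubmxK mul_row_col e1E e2E; apply/matrixP => i j.
  rewrite ord1 !mxE !big_ord_recl !big_ord0 !mxE.
  have -> : lift ord0 ord0 = 1 :> 'I_2 by apply: val_inj.
  have -> : ord0 = 0 :> 'I_2 by [].
  have -> : ord0 = 0 :> 'I_1 by [].
  by rewrite /c1 /c2 /c3; ring.
have dh a : dot a (c1 *: e1 x + c2 *: e2 x + c3 *: p1 x) = 0.
  by rewrite h dot0r.
have h1 := dh (e1 x); have h2 := dh (e2 x); have h3 := dh (p1 x); have h4 := dh (p2 x).
rewrite !dot_lin !E in h1 h2 h3 h4.
have c1E : c1 = 0 by lra.
have c3E : c3 = 0.
  by apply: (mulfI D); rewrite mulr0; rewrite c1E in h4; nra.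
have c2E : c2 = 0 by rewrite c3E in h2; lra.
apply/matrixP => i j; rewrite ord1 mxE; case: (split_ordP i) => k ->.
  by have [->|->] := ord2P k.
by rewrite ord1.
Qed.

End Orbit.

Lemma dim_codim (R : realType) (V : vectType R) (T W : {vspace V}) r (l : V -> 'rV[R]_r) :
  linear l -> (W <= T)%VS -> (forall w, w \in W -> l w = 0) ->
  (forall v, v \in T -> l v = 0 -> v \in W) ->
  (forall t, exists2 v, v \in T & l v = t) -> \dim T = (\dim W + r)%N.
Proof.
move=> llin WT W0 ker surj; have lE := linear_lfunE llin.
rewrite -(limg_ker_dim (linfun l) T); congr (_ + _)%N.
  congr (\dim _); apply/eqP; rewrite eqEsubv; apply/andP; split.
    apply/subvP => v /memv_capP[Tv]; rewrite memv_ker lE => /eqP; exact: ker.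
  apply/subvP => w Ww; rewrite memv_cap memv_ker lE W0 // eqxx andbT.
  exact: (subvP WT).
have -> : (linfun l @: T)%VS = fullv.
  apply/eqP; rewrite eqEsubv subvf; apply/subvP => t _.
  by have [v Tv <-] := surj t; rewrite -lE memv_img.
by rewrite dimvf /dim /= mul1n.
Qed.

Section Codimension.
Variables (R : realType) (n : nat).
Implicit Types (x u v w : phase R n) (C : 'M[R]_n).

(** Derivatives of the Gram entries not fixed by the constraints: [<p1, e2>], [<p1, p1>],
    [<p1, p2>], [<p2, p2>]. All four are used with [gram_det x != 0]; for n = 3 the value r = 3
    drops the last. *)
Definition gram_diff r x v : 'rV[R]_r := \row_(i < r)
  nth 0 [:: dot (p1 x) (e2 v) + dot (e2 x) (p1 v); 2 * dot (p1 x) (p1 v);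
    dot (p1 x) (p2 v) + dot (p2 x) (p1 v); 2 * dot (p2 x) (p2 v)] i.

Lemma gram_diff_linear r x : linear (gram_diff r x).
Proof.
move=> k u v; apply/rowP => -[i ir]; rewrite !mxE /= e2P p1P p2P !dot_lin.
by case: i ir => [|[|[|[|i]]]] _ /=; rewrite ?nth_nil; ring.
Qed.

Lemma gram_diff_rotation r x C : C^T = - C -> gram_diff r x (C *m x) = 0.
Proof.
move=> hC; have h a b : dot a (C *m b) + dot b (C *m a) = 0.
  by rewrite (dot_skewr a) // (dotC _ b) addNr.
apply/rowP => -[i ir]; rewrite !mxE /= e2M p1M p2M !h !dot_skew // mulr0.
by case: i ir => [|[|[|[|i]]]] _ //=; rewrite nth_nil.
Qed.

Lemma orbit_codim r x : cotangent_bundle x ->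
  (forall v, v \in tangent x -> gram_diff r x v = 0 -> v \in so_orbit x) ->
  (forall t : 'rV[R]_r, exists2 v, v \in tangent x & gram_diff r x v = t) ->
  \dim (tangent x) = (\dim (so_orbit x) + r)%N.
Proof.
move=> Mx ker surj; apply: (dim_codim (@gram_diff_linear r x)) => //.
- exact: so_orbit_tangent.
- by move=> _ /so_orbitP[C hC ->]; exact: gram_diff_rotation.
Qed.

Lemma vertical_tangent x (u1 u2 : 'cV[R]_n) : cotangent_bundle x ->
  dot (e1 x) u1 = 0 -> dot (e2 x) u2 = 0 -> dot (e1 x) u2 + dot (e2 x) u1 = 0 ->
  exists2 v, v \in tangent x &
   [/\ e1 v = 0, e2 v = 0, p1 v = u1 & p2 v = u2].
Proof.
move=> Mx h1 h2 h3; pose v : phase R n := mkp 0 (mkc u1 u2).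
have v1 : e1 v = 0 by rewrite /e1 /base row_mxKl /c1 linear0.
have v2 : e2 v = 0 by rewrite /e2 /base row_mxKl /c2 linear0.
have v3 : p1 v = u1 by rewrite /p1 /momentum row_mxKr c1_mk.
have v4 : p2 v = u2 by rewrite /p2 /momentum row_mxKr c2_mk.
exists v => //; apply/tangentP; rewrite v1 v2 v3 v4 !dot0r.
by split; [split|..]; lra.
Qed.

Lemma frame4_dual x (P : 'M[R]_(n, 2 + 2)) : x^T *m P = 1%:M ->
  forall a1 a2 a3 a4 : R, exists u : 'cV[R]_n,
    [/\ dot (e1 x) u = a1, dot (e2 x) u = a2, dot (p1 x) u = a3 & dot (p2 x) u = a4].
Proof.
move=> xP a1 a2 a3 a4.
pose c : 'cV[R]_(2 + 2) := col_mx (\col_i (if i == 0 then a1 else a2))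
  (\col_i (if i == 0 then a3 else a4)).
have E i : dot (col i x) (P *m c) = c i 0.
  rewrite -[c in RHS]mul1mx -xP -mulmxA [RHS]mxE dotE.
  by apply: eq_bigr => k _; rewrite !mxE.
exists (P *m c); rewrite e1E e2E p1E p2E !E.
by rewrite /c !col_mxEu !col_mxEd !mxE.
Qed.

Lemma frame3_dual x (P : 'M[R]_(n, 2 + 1)) : (frame3 x)^T *m P = 1%:M ->
  forall a1 a2 a3 : R, exists u : 'cV[R]_n,
    [/\ dot (e1 x) u = a1, dot (e2 x) u = a2 & dot (p1 x) u = a3].
Proof.
move=> xP a1 a2 a3.
pose c : 'cV[R]_(2 + 1) := col_mx (\col_i (if i == 0 then a1 else a2)) (\col_i a3).
have E i : dot (col i (frame3 x)) (P *m c) = c i 0.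
  rewrite -[c in RHS]mul1mx -xP -mulmxA [RHS]mxE dotE.
  by apply: eq_bigr => k _; rewrite !mxE.
have f1 : e1 x = col (lshift 1 0) (frame3 x).
  by apply/matrixP => i j; rewrite [RHS]mxE row_mxEl !mxE.
have f2 : e2 x = col (lshift 1 1) (frame3 x).
  by apply/matrixP => i j; rewrite [RHS]mxE row_mxEl !mxE.
have f3 : p1 x = col (rshift 2 0) (frame3 x).
  by apply/matrixP => i j; rewrite [RHS]mxE row_mxEr ord1.
exists (P *m c); rewrite f1 f2 f3 !E.
by rewrite /c !col_mxEu !col_mxEd !mxE.
Qed.

(** A tangent vector along which no Gram entry changes is an infinitesimal rotation, by
    [rotation_extension]. Conversely, moving only the momenta realizes every value of
    [gram_diff]. *)
Lemma orbit_codim4 x : cotangent_bundle x -> gram_det x != 0 ->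
  \dim (tangent x) = (\dim (so_orbit x) + 4)%N.
Proof.
move=> Mx D; have [P xP] := frame4 Mx D; apply: orbit_codim => //.
  move=> v Tv /rowP g0.
  have := g0 (Ordinal (isT : 0 < 4)%N); have := g0 (Ordinal (isT : 1 < 4)%N).
  have := g0 (Ordinal (isT : 2 < 4)%N); have := g0 (Ordinal (isT : 3 < 4)%N).
  rewrite !mxE /= => g3 g2 g1 {}g0.
  have /tangentP[[t1 t2 t3] t4 t5 t6] := Tv.
  have K : (x^T *m v)^T = - (x^T *m v).
    have gram i j : dot (col j x) (col i v) = - dot (col i x) (col j v).
      rewrite e1E e2E p1E p2E in g0 g1 g2 g3 t1 t2 t3 t4 t5 t6.
      move: i; apply: ord4_ind; move: j; apply: ord4_ind;
        rewrite !e1E !e2E !p1E !p2E in g0 g1 g2 g3 t1 t2 t3 t4 t5 t6; lra.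
    apply/matrixP => i j; rewrite [LHS]mxE [RHS]mxE.
    have E k l : (x^T *m v) k l = dot (col k x) (col l v).
      by rewrite dotE mxE; apply: eq_bigr => m _; rewrite !mxE.
    by rewrite !E gram.
  by have [C hC <-] := rotation_extension xP K; apply/so_orbitP; exists C.
move=> t; have dual := frame4_dual xP.
(* The halves undo the factor 2 in the derivatives of the squared norms; the entry [- t 0 0] of [u2]
   below restores the tangency condition linking the two momenta. *)
have [u1 [u11 u12 u13 u14]] := dual 0 (t 0 0) (t 0 1 / 2) (t 0 (inord 2)).
have [u2 [u21 u22 u23 u24]] := dual (- t 0 0) 0 0 (t 0 (inord 3) / 2).
have [|v Tv [v1 v2 v3 v4]] := vertical_tangent Mx u11 u22; first by rewrite u21 u12 addNr.
exists v => //; apply/rowP => i; rewrite mxE v2 v3 v4 u12 u13 u14 u23 u24 !dot0r.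
case: i => [[|[|[|[|]]]]] // i /=; rewrite ?add0r.
- by congr (t 0 _); apply: val_inj.
- by rewrite mulrCA divff ?mulr1 ?pnatr_eq0 //; congr (t 0 _); apply: val_inj.
- by congr (t 0 _); apply: val_inj; rewrite /= inordK.
- rewrite mulrCA divff ?mulr1 ?pnatr_eq0 //; congr (t 0 _); apply: val_inj.
  by rewrite /= inordK.
Qed.

End Codimension.

(** The frame (e1, e2, p1) determines the rotation. It also moves p2 correctly, because in dimension
    3 a vector is determined by its products with the frame. *)
Lemma orbit_codim3 (R : realType) (x : phase R 3) : cotangent_bundle x ->
  dot (p1 x) (p2 x) != 0 -> \dim (tangent x) = (\dim (so_orbit x) + 3)%N.
Proof.
move=> Mx D; have [P xP] := frame3P Mx D; apply: orbit_codim => //.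
  move=> v Tv /rowP g0.
  have := g0 (Ordinal (isT : 0 < 3)%N); have := g0 (Ordinal (isT : 1 < 3)%N).
  have := g0 (Ordinal (isT : 2 < 3)%N).
  rewrite !mxE /= => g2 g1 {}g0.
  have /tangentP[[t1 t2 t3] t4 t5 t6] := Tv.
  have col1 y : col (lshift 1 0) (frame3 y) = e1 y :> 'cV[R]_3.
    by apply/matrixP => i j; rewrite [LHS]mxE row_mxEl !mxE.
  have col2 y : col (lshift 1 1) (frame3 y) = e2 y :> 'cV[R]_3.
    by apply/matrixP => i j; rewrite [LHS]mxE row_mxEl !mxE.
  have col3 y : col (rshift 2 0) (frame3 y) = p1 y :> 'cV[R]_3.
    by apply/matrixP => i j; rewrite [LHS]mxE row_mxEr ord1.
  have K : ((frame3 x)^T *m frame3 v)^T = - ((frame3 x)^T *m frame3 v).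
    have gram i j : dot (col j (frame3 x)) (col i (frame3 v)) =
        - dot (col i (frame3 x)) (col j (frame3 v)).
      case: (split_ordP i) => k ->; [have [->|->] := ord2P k|rewrite (ord1 k)];
      case: (split_ordP j) => l ->;
      [have [->|->] := ord2P l|rewrite (ord1 l)|have [->|->] := ord2P l
      |rewrite (ord1 l)|have [->|->] := ord2P l|rewrite (ord1 l)];
      rewrite ?col1 ?col2 ?col3; lra.
    apply/matrixP => i j; rewrite [LHS]mxE [RHS]mxE.
    have E k l : ((frame3 x)^T *m frame3 v) k l = dot (col k (frame3 x)) (col l (frame3 v)).
      by rewrite dotE mxE; apply: eq_bigr => m _; rewrite !mxE.
    by rewrite !E gram.
  have [C hC CE] := rotation_extension xP K; apply/so_orbitP; exists C => //.
  have c1E : e1 v = C *m e1 x by rewrite -!col1 -CE !colE mulmxA.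
  have c2E : e2 v = C *m e2 x by rewrite -!col2 -CE !colE mulmxA.
  have c3E : p1 v = C *m p1 x by rewrite -!col3 -CE !colE mulmxA.
  apply: phase_eq; rewrite ?e1M ?e2M ?p1M ?p2M //.
  apply/eqP; rewrite -subr_eq0; apply/eqP; set w := _ - _.
  have xw : (frame3 x)^T *m w = 0.
    have E k : ((frame3 x)^T *m w) k 0 = dot (col k (frame3 x)) w.
      by rewrite dotE mxE; apply: eq_bigr => m _; rewrite !mxE.
    have h a b : dot a (C *m b) = - dot b (C *m a).
      by rewrite dot_skewr // (dotC _ b).
    apply/matrixP => k j; rewrite ord1 E [RHS]mxE /w !dot_lin.
    case: (split_ordP k) => l ->; [have [->|->] := ord2P l|rewrite (ord1 l)];
      rewrite ?col1 ?col2 ?col3 h -?c1E -?c2E -?c3E; lra.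
  (* The frame is a square matrix here, so its one-sided inverse is two-sided and [w] vanishes. *)
  have PY : P *m (frame3 x)^T = 1%:M by apply: mulmx1C.
  by rewrite -[w]mul1mx -PY -mulmxA xw mulmx0.
move=> t; have dual := frame3_dual xP.
have [u1 [u11 u12 u13]] := dual 0 (t 0 0) (t 0 1 / 2).
have [u2 [u21 u22 u23]] := dual (- t 0 0) 0 (t 0 (inord 2) - dot (p2 x) u1).
have [|v Tv [v1 v2 v3 v4]] := vertical_tangent Mx u11 u22; first by rewrite u21 u12 addNr.
exists v => //; apply/rowP => i; rewrite mxE v2 v3 v4 u12 u13 u23 !dot0r.
case: i => [[|[|[|]]]] // i /=; rewrite ?add0r.
- by congr (t 0 _); apply: val_inj.
- by rewrite mulrCA divff ?mulr1 ?pnatr_eq0 //; congr (t 0 _); apply: val_inj.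
- by rewrite subrK; congr (t 0 _); apply: val_inj; rewrite /= inordK.
Qed.

(** * Generic points *)

Section GenericPoint.
Variables (R : realType) (n : nat) (eta : R).
Implicit Types (x u v w : phase R n) (C : 'M[R]_n).

Lemma Phi_mul x (a : 'cV[R]_n) : Phi eta x *m a =
  dot (e1 x) a *: p1 x - dot (p1 x) a *: e1 x
  + (dot (e2 x) a *: p2 x - dot (p2 x) a *: e2 x)
  + eta *: (dot (e2 x) a *: e1 x - dot (e1 x) a *: e2 x).
Proof.
have W (u v : 'cV[R]_n) : wedge u v *m a = dot v a *: u - dot u a *: v.
  rewrite /wedge mulmxBl -!mulmxA /dot.
  have s (b c : 'cV[R]_n) : b *m (c^T *m a) = (c^T *m a) 0 0 *: b.
    by rewrite [c^T *m a]mx11_scalar mul_mx_scalar !mxE mulr1n.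
  by rewrite !s.
have L (M N Q : 'M[R]_n) : (M + N + eta *: Q) *m a = M *m a + N *m a + eta *: (Q *m a).
  by rewrite !mulmxDl -scalemxAl.
by rewrite /Phi L !W.
Qed.

Definition Phi_cube x : 'M[R]_n := Phi eta x *m Phi eta x *m Phi eta x.

Lemma Phi_cube_skew x : (Phi_cube x)^T = - Phi_cube x.
Proof. by rewrite /Phi_cube !trmx_mul !Phi_skew !(mulmxN, mulNmx) opprK mulmxA. Qed.

Lemma Phi_cube_comm x : Phi_cube x *m Phi eta x = Phi eta x *m Phi_cube x.
Proof. by rewrite /Phi_cube !mulmxA. Qed.

Lemma Phi_frame x : cotangent_bundle x -> let m := dot (p1 x) (e2 x) in
  [/\ Phi eta x *m e1 x = p1 x + (m - eta) *: e2 x,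
      Phi eta x *m e2 x = p2 x + (eta - m) *: e1 x,
      Phi eta x *m p1 x = (eta * m - dot (p1 x) (p1 x)) *: e1 x
        - dot (p1 x) (p2 x) *: e2 x + m *: p2 x
    & Phi eta x *m p2 x = (eta * m - dot (p2 x) (p2 x)) *: e2 x
        - dot (p1 x) (p2 x) *: e1 x - m *: p1 x].
Proof.
move=> Mx m; have E := cotangent_dots Mx.
by split; rewrite Phi_mul !E -/m; apply/matrixP => i j; rewrite !mxE; ring.
Qed.

(** The product of the first column of [Phi x] with p2 is [<p1, p2>]. *)
Lemma Phi_rotation_neq0 x : cotangent_bundle x -> dot (p1 x) (p2 x) != 0 ->
  Phi eta x *m x != 0.
Proof.
move=> Mx D; have E := cotangent_dots Mx; apply: contraNneq D => /(congr1 (@e1 R n)).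
rewrite e1M Phi_mul => /(congr1 (fun a => dot a (p2 x))).
have -> : e1 (0 : phase R n) = 0 by rewrite e1E; apply/matrixP => i j; rewrite !mxE.
rewrite !dot_lin !E => h; apply/eqP; lra.
Qed.

(** In the frame (e1, e2, p1, p2), the p1-coefficient of Phi e2 is 0, while that of Phi^3 e2 is
    [- <p1, p2>]. The dual vector [w] extracts this coefficient. *)
Lemma Phi_cube_notin x : cotangent_bundle x -> gram_det x != 0 ->
  dot (p1 x) (p2 x) != 0 -> Phi_cube x *m x \notin <[Phi eta x *m x]>%VS.
Proof.
move=> Mx D D'; have E := cotangent_dots Mx; have [P xP] := frame4 Mx D.
have [w [w1 w2 w3 w4]] := frame4_dual xP 0 0 1 0.
apply: contraNN D' => /vlineP[k] /(congr1 (fun y => dot (e2 y) w)).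
have e2Z y : e2 (k *: y) = k *: e2 y by rewrite !e2E; apply/matrixP => i j; rewrite !mxE.
have [f1 f2 f3 f4] := Phi_frame Mx.
rewrite e2Z /Phi_cube !e2M -!mulmxA.
do 3! rewrite ?(mulmxDr, mulmxN, =^~ scalemxAr) ?(f1, f2, f3, f4).
by rewrite !dot_lin ?w1 w2 w3 w4 => h; apply/eqP; lra.
Qed.

(** Here [r] is the torus dimension and [N] consists of rotation fields commuting with [Phi].
    Adjoining the Hamiltonian vector to [so_orbit x] and to [N] yields a coisotropic space and its
    skew complement, of dimension [r]. *)
Lemma generic_point (H : phase R n -> R) r x (N : {vspace phase R n}) :
  cotangent_bundle x -> smooth H ->
  (forall C, C^T = - C -> 'd H x (C *m x) = 0) ->
  vsval (ham_vector eta (dfun H x)) \notin so_orbit x ->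
  \dim (tangent x) = (\dim (so_orbit x) + r.+1)%N ->
  (forall u, u \in N -> exists2 C : 'M[R]_n, C^T = - C &
     C *m Phi eta x = Phi eta x *m C /\ u = C *m x) ->
  (\dim N).+1 = r ->
  let D := differentials (generated_algebra (integral_generators eta H)) x in
  (\dim D + \dim (poisson_kernel eta D) = \dim (tangent x))%N /\
  (\dim D + r = \dim (tangent x))%N.
Proof.
set X := vsval _ => Mx sH inv XO dimT Ncomm dimN.
have dHX v : v \in tangent x -> omega eta X v = - 'd H x v.
  move=> Tv; have := ham_vectorP eta (dfun H x) (vsproj (tangent x) v) Mx.
  by rewrite dfunE vsprojK.
have TX : X \in tangent x by exact: subvsP.
pose W := (so_orbit x + <[X]>)%VS; pose N' := (N + <[X]>)%VS.
have NO : (N <= so_orbit x)%VS.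
  by apply/subvP => u /Ncomm[C hC [_ ->]]; apply/so_orbitP; exists C.
have WT : (W <= tangent x)%VS by rewrite subv_add so_orbit_tangent -memvE.
have N'W : (N' <= W)%VS by apply: addvS.
have X0 C : C^T = - C -> omega eta X (C *m x) = 0.
  by move=> hC; rewrite dHX ?inv ?oppr0 //; exact: rotation_tangent.
have N'W0 u w : u \in N' -> w \in W -> omega eta u w = 0.
  move=> /memv_addP[u0 /Ncomm[C hC [CPhi ->]] [_ /vlineP[k ->] ->]].
  move=> /memv_addP[_ /so_orbitP[B hB ->] [_ /vlineP[l ->] ->]].
  have XX : omega eta X X = 0 by have := omegaC eta X X; lra.
  rewrite addrC omegaPl (omegaC _ X) (omegaC _ (C *m x)) [_ + l *: X]addrC !omegaPl.
  rewrite (omegaC _ (B *m x) (C *m x)) omega_rotation_rotation // XX.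
  by rewrite (omegaC _ (B *m x)) !X0 //; ring.
have dimW : \dim W = (\dim (so_orbit x)).+1 by exact: dim_add_line.
have dimN' : \dim N' = r.
  by rewrite dim_add_line //; apply: contraNN XO => /(subvP NO).
have dimWN : (\dim W + \dim N')%N = \dim (tangent x) by rewrite dimW dimN' dimT addSnnS.
have [dimU dimK] := coisotropic_dim Mx WT N'W N'W0 dimWN.
have Ssm : integral_generators eta H `<=` @smooth R n.
  move=> f [[i [j [_ ->]]]|-> //].
  by apply: polyfun_smooth; exact: polyfun_Phi_coord.
have DE := differentials_generated Ssm (differentials_generators eta Mx sH).
move=> D; have -> : D = (flatT eta x @: W)%VS by exact: DE.
by split; [exact: dimK|rewrite dimU -dimN' dimWN].
Qed.

End GenericPoint.

Section Density.
Variables (R : realType) (n : nat).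
Implicit Types (x y : phase R n) (D : phase R n -> R).

(** With the base point fixed, the remaining constraints are linear in the momenta. *)
Lemma cotangent_line x y t : cotangent_bundle x -> cotangent_bundle y ->
  base y = base x -> cotangent_bundle (x + t *: (y - x)).
Proof.
move=> [Sx k1 k2 k12] [Sy l1 l2 l12] yx.
have b : base (x + t *: (y - x)) = base x.
  by rewrite addrC /base linearP linearB /= -/(base y) -/(base x) yx subrr scaler0 add0r.
have l1' : dot (e1 x) (p1 y) = 0 by rewrite /e1 -yx.
have l2' : dot (e2 x) (p2 y) = 0 by rewrite /e2 -yx.
have l12' : dot (e1 x) (p2 y) + dot (e2 x) (p1 y) = 0 by rewrite /e1 /e2 -yx.
have p1Z z z' : p1 (z + t *: (z' - z)) = p1 z + t *: (p1 z' - p1 z).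
  by rewrite !p1E; apply/matrixP => i j; rewrite !mxE.
have p2Z z z' : p2 (z + t *: (z' - z)) = p2 z + t *: (p2 z' - p2 z).
  by rewrite !p2E; apply/matrixP => i j; rewrite !mxE.
split; rewrite ?b // /e1 /e2 b -/(e1 x) -/(e2 x) ?p1Z ?p2Z !dot_lin.
- by rewrite k1 l1'; ring.
- by rewrite k2 l2'; ring.
by rewrite -[RHS](mulr0 (1 - t)) -k12 -[RHS]addr0 -[X in _ = _ + X](mulr0 t) -l12'; ring.
Qed.

(** Join [x] to a good point [y] of the same fibre. On this line D is a polynomial in t, nonzero at
    t = 1, hence nonzero for arbitrarily small t > 0, so good points accumulate at [x]. *)
Lemma polyfun_generic D (P : set (phase R n)) : polyfun D ->
  (forall x, cotangent_bundle x ->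
     exists y, [/\ cotangent_bundle y, base y = base x & D y != 0]) ->
  (forall x, cotangent_bundle x -> D x != 0 -> P x) -> generic P.
Proof.
move=> pD exD DP; exists (D @^-1` [set~ 0]); split; last first.
- by move=> x [/= /eqP Dx Mx]; exact: DP.
- move=> x Mx B Bx; have [y [My yx Dy]] := exD x Mx.
  have [q qE] := polyfun_line x (y - x) pD.
  have q0 : q != 0.
    by apply: contraNneq Dy => q0; rewrite -(subrK x y) addrC -[y - x]scale1r qE q0 horner0.
  have cvg : (fun t : R => x + t *: (y - x)) @ (0 : R) --> x.
    rewrite -[X in _ --> X]addr0 -(scale0r (y - x)).
    by apply: cvgD; [exact: cvg_cst|apply: cvgZl; exact: cvg_id].
  have := cvg _ Bx; rewrite /= => /nbhs_ballP[e /= e0 eB].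
  have [t /andP[t0 te] qt] := polynomial_small_nonroot q0 e0.
  exists (x + t *: (y - x)); split.
    by split; [apply/eqP; rewrite qE|exact: cotangent_line].
  by apply: eB; rewrite /ball /= sub0r normrN gtr0_norm.
- apply: open_comp => [x _|]; first exact: polyfun_continuous.
  rewrite openC; apply: accessible_closed_set1; apply: hausdorff_accessible.
  exact: norm_hausdorff.
Qed.

End Density.

(** * Integrability *)

Section Witness.
Variables (R : realType) (n : nat).
Implicit Types (x y : phase R n).

Lemma unit_orthogonal k (Y : 'M[R]_(n, k)) : (k < n)%N ->
  exists u : 'cV[R]_n, dot u u = 1 /\ forall i, dot (col i Y) u = 0.
Proof.
move=> kn; have K0 : kermx Y != 0.
  rewrite -mxrank_eq0 mxrank_ker subn_eq0 -ltnNge.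
  exact: leq_ltn_trans (rank_leq_col Y) kn.
pose v := nz_row (kermx Y); have v0 : v != 0 by rewrite nz_row_eq0.
have vY : v *m Y = 0 by apply: sub_kermxP; exact: nz_row_sub.
have d0 : 0 < dot v^T v^T.
  rewrite lt_neqAle dot_ge0 andbT eq_sym; apply: contra v0 => /eqP/dot_eq0 h.
  by rewrite -[v]trmxK h trmx0.
pose s := Num.sqrt (dot v^T v^T); have s0 : s != 0 by rewrite gt_eqF // sqrtr_gt0.
exists (s^-1 *: v^T); split.
  rewrite dotZl dotZr -[dot _ _]sqr_sqrtr ?ltW // -/s expr2; field; exact: s0.
move=> i; have E : dot (col i Y) v^T = (v *m Y) 0 i.
  by rewrite dotE mxE; apply: eq_bigr => l _; rewrite !mxE mulrC.
by rewrite dotZr E vY mxE mulr0.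
Qed.

(** The momenta are p1 = m e2 + a e3 and p2 = - m e1 + b e3 + d f, with e3 and f orthonormal and
    orthogonal to e1, e2. A unit vector f exists only for n at least 4, whence the condition on
    d. *)
Lemma frame_point x (m a b d : R) : (3 <= n)%N -> cotangent_bundle x ->
  ((4 <= n)%N \/ d = 0) ->
  exists y, [/\ cotangent_bundle y, base y = base x &
   [/\ dot (p1 y) (e2 y) = m, dot (p1 y) (p1 y) = m ^+ 2 + a ^+ 2,
       dot (p2 y) (p2 y) = m ^+ 2 + b ^+ 2 + d ^+ 2 & dot (p1 y) (p2 y) = a * b]].
Proof.
move=> n3 Mx hd; have E := cotangent_dots Mx.
have [e3 [e33 e3o]] := unit_orthogonal (base x) n3.
have e31 : dot (e1 x) e3 = 0 by exact: e3o.
have e32 : dot (e2 x) e3 = 0 by exact: e3o.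
(* The norm of f is stated up to the factor d^2 so that f = 0 serves when d = 0. *)
have [f [ff [f1 f2 f3]]] : exists f : 'cV[R]_n, d ^+ 2 * dot f f = d ^+ 2 /\
    [/\ dot (e1 x) f = 0, dot (e2 x) f = 0 & dot e3 f = 0].
  case: hd => [n4|->]; last first.
    by exists 0; rewrite expr0n mul0r !dot0r.
  have [f [ff fo]] := unit_orthogonal (row_mx (base x) e3 : 'M[R]_(n, 2 + 1)) n4.
  exists f; rewrite ff mulr1; split=> //; split.
  - by rewrite -(fo (lshift 1 0)); congr dot;
      apply/matrixP => i j; rewrite [RHS]mxE row_mxEl !mxE.
  - by rewrite -(fo (lshift 1 1)); congr dot;
      apply/matrixP => i j; rewrite [RHS]mxE row_mxEl !mxE.
  - by rewrite -(fo (rshift 2 0)); congr dot;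
      apply/matrixP => i j; rewrite [RHS]mxE row_mxEr ord1.
pose q1 := m *: e2 x + a *: e3.
pose q2 := - m *: e1 x + b *: e3 + d *: f.
pose y : phase R n := mkp (base x) (mkc q1 q2).
have yb : base y = base x by rewrite /base row_mxKl.
have y1 : e1 y = e1 x by rewrite /e1 yb.
have y2 : e2 y = e2 x by rewrite /e2 yb.
have y3 : p1 y = q1 by rewrite /p1 /momentum row_mxKr c1_mk.
have y4 : p2 y = q2 by rewrite /p2 /momentum row_mxKr c2_mk.
have [Sx _ _ _] := Mx.
exists y; split=> //.
  split; rewrite ?yb // ?y1 ?y2 ?y3 ?y4 /q1 /q2 !dot_lin ?E ?e31 ?e32 ?f1 ?f2; ring.
rewrite y2 y3 y4 /q1 /q2 !dot_lin !(dotC e3 (e2 x)) !(dotC e3 (e1 x)) !(dotC f) !E.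
rewrite e31 e32 f1 f2 f3 e33; split; try ring.
by rewrite -[in RHS]ff; ring.
Qed.

End Witness.

Section Integrability.
Variables (R : realType) (n : nat) (eta : R).
Implicit Types (x y : phase R n) (C : 'M[R]_n) (H D h : phase R n -> R).

(** Invariance of [H] makes all generators first integrals with brackets in the algebra, and both
    properties pass to the algebra. The dimension counts hold where D is nonzero, a generic
    condition. *)
Lemma integrable_of_generic H D r : polyfun H -> polyfun D ->
  (forall x C, C^T = - C -> 'd H x (C *m x) = 0) ->
  (forall x, cotangent_bundle x ->
     exists y, [/\ cotangent_bundle y, base y = base x & D y != 0]) ->
  let F := generated_algebra (integral_generators eta H) in
  (forall x, cotangent_bundle x -> D x != 0 ->
    (\dim (differentials F x) + \dim (poisson_kernel eta (differentials F x))
      = \dim (tangent x))%N /\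
    (\dim (differentials F x) + r = \dim (tangent x))%N) ->
  [/\ nc_integrable eta H, complete_algebra eta F,
      forall f, F f -> first_integral eta H f & invariant_tori_dim F r].
Proof.
move=> pH pD inv exD F dims; have sH := polyfun_smooth pH.
have aF : function_algebra F by exact: generated_function_algebra.
have Ssm : integral_generators eta H `<=` @smooth R n.
  move=> f [[i [j [_ ->]]]|-> //].
  by apply: polyfun_smooth; exact: polyfun_Phi_coord.
have PhiH i j x : cotangent_bundle x -> bracket eta (Phi_coord eta i j) H x = 0.
  by move=> Mx; apply: Phi_coord_bracket => // C; exact: inv.
have FI f : F f -> first_integral eta H f.
  move: f; apply: generated_ind; first exact: first_integral_algebra.
  move=> f [[i [j [_ ->]]]|->]; apply: first_integral_bracket => //.
  - by apply: polyfun_smooth; exact: polyfun_Phi_coord.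
  - by move=> x Mx; exact: PhiH.
  - by move=> x Mx; exact: bracket_self.
have FC : complete_algebra eta F.
  split=> //.
  - by apply: generated_ind => //; exact: smooth_algebra.
  - apply: generated_bracket => // f f' [[i [j [ij ->]]]|->] [[k [l [kl ->]]]|->].
    + apply: Phi_coord_closed => // i' j' ij'.
      by apply: sub_generated; left; exists i', j'.
    + by exists (fun=> 0); [exact: algebra_cst|move=> x Mx; rewrite PhiH].
    + exists (fun=> 0); [exact: algebra_cst|move=> x Mx].
      by rewrite bracketC // PhiH // oppr0.
    + by exists (fun=> 0); [exact: algebra_cst|move=> x Mx; rewrite bracket_self].
  - by apply: (polyfun_generic pD exD) => x Mx Dx; have [] := dims x Mx Dx.
split=> //; first by exists F.
by apply: (polyfun_generic pD exD) => x Mx Dx; have [] := dims x Mx Dx.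
Qed.

Lemma polyfun_dotf (f g : phase R n -> 'cV[R]_n) j k :
  f = col j -> g = col k -> polyfun (fun x => dot (f x) (g x)).
Proof. by move=> -> ->; exact: polyfun_dot. Qed.

Lemma is_diff_dotf (f g : phase R n -> 'cV[R]_n) j k x :
  f = col j -> g = col k ->
  is_diff x (fun y => dot (f y) (g y)) (fun v => dot (f v) (g x) + dot (f x) (g v)).
Proof. by move=> -> ->; exact: dot_diff. Qed.

Lemma polyfun_gram_det : polyfun (@gram_det R n).
Proof.
have aP := @polyfun_algebra R n.
have d22 := polyfun_dotf (funext (@p2E R n)) (funext (@p2E R n)).
have d11 := polyfun_dotf (funext (@p1E R n)) (funext (@p1E R n)).
have d12 := polyfun_dotf (funext (@p1E R n)) (funext (@p2E R n)).
have m12 := polyfun_dotf (funext (@p1E R n)) (funext (@e2E R n)).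
have sq f : polyfun f -> polyfun (fun x => f x ^+ 2).
  by move=> pf; exact: (algebra_mul aP).
by apply: (algebra_sub aP); [apply: (algebra_mul aP);
  apply: (algebra_sub aP)|]; rewrite //; exact: sq.
Qed.

Definition integrability_conclusion H : Prop :=
  let F := generated_algebra (integral_generators eta H) in
  [/\ nc_integrable eta H, complete_algebra eta F,
      forall f, F f -> first_integral eta H f,
      (4 <= n)%N -> invariant_tori_dim F 3
    & n = 3%N -> invariant_tori_dim F 2].

End Integrability.

(** * Transversality of the Hamiltonian vector and the two families of Hamiltonians *)

Section Transverse.
Variables (R : realType) (n : nat) (eta : R).
Implicit Types (x y v : phase R n) (C : 'M[R]_n) (H h : phase R n -> R).

(** The function [h] detects transversality of the Hamiltonian vector to the orbit. The last
    hypothesis supplies, for each d, parameters for [frame_point] at which both [h] and [<p1, p2>]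
    are nonzero. *)
Lemma integrable_of_transverse H h : (3 <= n)%N -> polyfun H -> polyfun h ->
  (forall x C, C^T = - C -> 'd H x (C *m x) = 0) ->
  (forall x, cotangent_bundle x -> dot (p1 x) (p2 x) != 0 -> h x != 0 ->
     vsval (ham_vector eta (dfun H x)) \notin so_orbit x) ->
  (forall d : R, exists m a b : R, a * b != 0 /\
     forall y, cotangent_bundle y -> dot (p1 y) (e2 y) = m ->
       dot (p1 y) (p1 y) = m ^+ 2 + a ^+ 2 ->
       dot (p2 y) (p2 y) = m ^+ 2 + b ^+ 2 + d ^+ 2 ->
       dot (p1 y) (p2 y) = a * b -> h y != 0) ->
  integrability_conclusion eta H.
Proof.
move=> n3 pH ph inv trans wit.
have aP := @polyfun_algebra R n; have sH := polyfun_smooth pH.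
have pC := polyfun_dotf (funext (@p1E R n)) (funext (@p2E R n)).
have [n4|] := leqP 4 n.
  pose D x := dot (p1 x) (p2 x) * h x * gram_det x.
  have pD : polyfun D.
    apply: (algebra_mul aP); last exact: polyfun_gram_det.
    exact: (algebra_mul aP).
  have exD x : cotangent_bundle x ->
      exists y, [/\ cotangent_bundle y, base y = base x & D y != 0].
    (* With d = 1 the Gram determinant of the point is a^2. In dimension 3 below, d = 0 is forced
       and no Gram determinant is required. *)
    move=> Mx; have [m [a [b [ab0 hy]]]] := wit 1.
    have [y [My yx [y1 y2 y3 y4]]] := @frame_point R n x m a b 1 n3 Mx (or_introl n4).
    exists y; split=> //; rewrite /D !mulf_neq0 ?y4 ?hy //.
    rewrite /gram_det y1 y2 y3 y4 (_ : _ - _ = a ^+ 2); last by ring.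
    by rewrite sqrf_eq0; apply: contraNneq ab0 => ->; rewrite mul0r.
  have dims x : cotangent_bundle x -> D x != 0 -> _ := fun Mx Dx =>
    @generic_point R n eta H 3 x
      (<[Phi eta x *m x]> + <[Phi_cube eta x *m x]>)%VS Mx sH (inv x).
  have [|nc FC FI tori] := @integrable_of_generic R n eta H D 3 pH pD inv exD.
    move=> x Mx Dx; have := Dx; rewrite /D !mulf_eq0 !negb_or => /andP[/andP[C0 h0] G0].
    apply: (dims x Mx Dx).
    - exact: trans.
    - exact: orbit_codim4.
    - move=> _ /memv_addP[_ /vlineP[k ->] [_ /vlineP[l ->] ->]].
      exists (k *: Phi eta x + l *: Phi_cube eta x).
        rewrite linearD /= !linearZ /= Phi_skew Phi_cube_skew.
        by rewrite !scalerN -opprD.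
      split; last by rewrite [RHS]mulmxDl -!scalemxAl.
      by rewrite [LHS]mulmxDl [RHS]mulmxDr -!scalemxAl -!scalemxAr Phi_cube_comm.
    - rewrite dim_add_line; last exact: Phi_cube_notin.
      by rewrite dim_vline Phi_rotation_neq0.
  by split=> // n_3; exfalso; move: n4; rewrite n_3.
rewrite ltnS => n3'; have n_3 : n = 3%N by apply/eqP; rewrite eqn_leq n3' n3.
pose D x := dot (p1 x) (p2 x) * h x.
have pD : polyfun D by exact: (algebra_mul aP).
have exD x : cotangent_bundle x ->
    exists y, [/\ cotangent_bundle y, base y = base x & D y != 0].
  move=> Mx; have [m [a [b [ab0 hy]]]] := wit 0.
  have [y [My yx [y1 y2 y3 y4]]] := @frame_point R n x m a b 0 n3 Mx (or_intror erefl).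
  by exists y; split=> //; rewrite /D mulf_neq0 ?y4 ?hy.
have [|nc FC FI tori] := @integrable_of_generic R n eta H D 2 pH pD inv exD.
  move=> x Mx Dx; have := Dx; rewrite /D !mulf_eq0 !negb_or => /andP[C0 h0].
  apply: (@generic_point R n eta H 2 x <[Phi eta x *m x]>%VS Mx sH (inv x)).
  - exact: trans.
  - by move: {+}x Mx C0; rewrite n_3 => *; exact: orbit_codim3.
  - move=> _ /vlineP[k ->]; exists (k *: Phi eta x).
      by rewrite linearZ /= Phi_skew scalerN.
    by split; rewrite -!scalemxAl -?scalemxAr.
  - by rewrite dim_vline Phi_rotation_neq0.
by split=> // n4; exfalso; move: n4; rewrite n_3.
Qed.

(* Velocity of the right SO(2)-action rotating (e1, e2) and (p1, p2). *)
Definition spin x : phase R n :=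
  mkp (mkc (- e2 x) (e1 x)) (mkc (- p2 x) (p1 x)).

Lemma spinE x : [/\ e1 (spin x) = - e2 x, e2 (spin x) = e1 x,
  p1 (spin x) = - p2 x & p2 (spin x) = p1 x].
Proof.
by rewrite /e1 /e2 /p1 /p2 /base /momentum row_mxKl row_mxKr !c1_mk !c2_mk.
Qed.

Lemma spin_tangent x : cotangent_bundle x -> spin x \in tangent x.
Proof.
move=> Mx; have E := cotangent_dots Mx; have [s1 s2 s3 s4] := spinE x.
by apply/tangentP; rewrite s1 s2 s3 s4 !dot_lin !E; split; [split|..]; lra.
Qed.

(** On tangent vectors [spin x] is the Hamiltonian vector of [-2 <p1, e2>]; the terms in [eta]
    cancel because e1 and e2 keep unit length. *)
Lemma omega_spin x v : v \in tangent x ->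
  omega eta (spin x) v = 2 * (dot (p1 x) (e2 v) + dot (e2 x) (p1 v)).
Proof.
move=> /tangentP[[t1 t2 t3] t4 t5 t6]; have [s1 s2 s3 s4] := spinE x.
rewrite /omega s1 s2 s3 s4 !dot_lin (dotC (e1 v) (e1 x)) (dotC (p1 v)) (dotC (p2 v)).
by rewrite t1 t2; lra.
Qed.

(** Rotations preserve [<p1, e2>], so the orbit is omega-orthogonal to [spin x], whereas the
    Hamiltonian vector pairs with it to [- dH(spin x)]. *)
Lemma spin_transverse H x : cotangent_bundle x -> 'd H x (spin x) != 0 ->
  vsval (ham_vector eta (dfun H x)) \notin so_orbit x.
Proof.
move=> Mx; set X := vsval _; apply: contraNN => OX; apply/eqP.
have TX : X \in tangent x by exact: subvsP.
have : omega eta X (spin x) = - 'd H x (spin x).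
  have := ham_vectorP eta (dfun H x) (vsproj (tangent x) (spin x)) Mx.
  by rewrite dfunE vsprojK // spin_tangent.
rewrite omegaC omega_spin //; move: OX => /so_orbitP[C hC ->].
by rewrite e2M p1M (dot_skewr (p1 x)) // (dotC (e2 x)) addNr; lra.
Qed.

(** Rotations preserve [<p1, p1>], which [spin] changes at the rate [-2 <p1, p2>]. *)
Lemma spin_notin_orbit x : cotangent_bundle x -> dot (p1 x) (p2 x) != 0 ->
  spin x \notin so_orbit x.
Proof.
move=> Mx; have E := cotangent_dots Mx; have [_ _ s3 _] := spinE x.
apply: contraNN => /so_orbitP[C hC sC].
have := dot_skew (p1 x) hC; rewrite -p1M -sC s3 dotNr => h; apply/eqP; lra.
Qed.

Lemma H_contact_diff (a1 a2 a4 : R) x v : 'd (H_contact a1 a2 a4) x v =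
  a1 * dot (p1 x) (p1 v) + a2 * dot (p2 x) (p2 v)
  + 1 / 2 * (a1 + a2) * (dot (p1 x) (e2 x) * (dot (p2 v) (e1 x) + dot (p2 x) (e1 v))
    + dot (p2 x) (e1 x) * (dot (p1 v) (e2 x) + dot (p1 x) (e2 v)))
  + a4 * (dot (p1 v) (p2 x) + dot (p1 x) (p2 v)).
Proof.
have E1 := funext (@e1E R n); have E2 := funext (@e2E R n).
have P1 := funext (@p1E R n); have P2 := funext (@p2E R n).
have d11 := is_diff_dotf x P1 P1; have d22 := is_diff_dotf x P2 P2.
have d12 := is_diff_dotf x P1 P2.
have m1 := is_diff_dotf x P1 E2; have m2 := is_diff_dotf x P2 E1.
have D := is_diff_addf (is_diff_addf (is_diff_addf (is_diff_scalef (1 / 2 * a1) d11)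
  (is_diff_scalef (1 / 2 * a2) d22))
  (is_diff_scalef (1 / 2 * (a1 + a2)) (is_diff_mulf m1 m2))) (is_diff_scalef a4 d12).
by rewrite (is_diffE v D) (dotC (p1 v) (p1 x)) (dotC (p2 v) (p2 x)); field.
Qed.

Lemma H_D0_diff (a1 a3 : R) x v : 'd (H_D0 a1 a3) x v =
  a1 * dot (p1 x) (p1 v)
  + a3 * (dot (p1 x) (e2 x) * (dot (p2 v) (e1 x) + dot (p2 x) (e1 v))
    + dot (p2 x) (e1 x) * (dot (p1 v) (e2 x) + dot (p1 x) (e2 v))).
Proof.
have E1 := funext (@e1E R n); have E2 := funext (@e2E R n).
have P1 := funext (@p1E R n); have P2 := funext (@p2E R n).
have d11 := is_diff_dotf x P1 P1.
have m1 := is_diff_dotf x P1 E2; have m2 := is_diff_dotf x P2 E1.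
have D := is_diff_addf (is_diff_scalef (1 / 2 * a1) d11)
  (is_diff_scalef a3 (is_diff_mulf m1 m2)).
by rewrite (is_diffE v D) (dotC (p1 v) (p1 x)); field.
Qed.

Lemma H_contact_invariant (a1 a2 a4 : R) x C : C^T = - C ->
  'd (H_contact a1 a2 a4) x (C *m x) = 0.
Proof.
move=> hC; have h a b : dot (C *m a) b + dot a (C *m b) = 0.
  by rewrite (dot_skewr a) // addrN.
by rewrite H_contact_diff e1M e2M p1M p2M !h !dot_skew //; ring.
Qed.

Lemma H_D0_invariant (a1 a3 : R) x C : C^T = - C -> 'd (H_D0 a1 a3) x (C *m x) = 0.
Proof.
move=> hC; have h a b : dot (C *m a) b + dot a (C *m b) = 0.
  by rewrite (dot_skewr a) // addrN.
by rewrite H_D0_diff e1M e2M p1M p2M !h !dot_skew //; ring.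
Qed.

Lemma polyfun_H_contact (a1 a2 a4 : R) : polyfun (@H_contact R n a1 a2 a4).
Proof.
have aP := @polyfun_algebra R n.
have E1 := funext (@e1E R n); have E2 := funext (@e2E R n).
have P1 := funext (@p1E R n); have P2 := funext (@p2E R n).
have d11 := polyfun_dotf P1 P1; have d22 := polyfun_dotf P2 P2.
have d12 := polyfun_dotf P1 P2.
have m1 := polyfun_dotf P1 E2; have m2 := polyfun_dotf P2 E1.
exact: (algebra_add aP (algebra_add aP (algebra_add aP
  (algebra_scale aP _ d11) (algebra_scale aP _ d22))
  (algebra_scale aP _ (algebra_mul aP m1 m2))) (algebra_scale aP _ d12)).
Qed.

Lemma polyfun_H_D0 (a1 a3 : R) : polyfun (@H_D0 R n a1 a3).
Proof.
have aP := @polyfun_algebra R n.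
have E1 := funext (@e1E R n); have E2 := funext (@e2E R n).
have P1 := funext (@p1E R n); have P2 := funext (@p2E R n).
have d11 := polyfun_dotf P1 P1.
have m1 := polyfun_dotf P1 E2; have m2 := polyfun_dotf P2 E1.
exact: (algebra_add aP (algebra_scale aP _ d11)
  (algebra_scale aP _ (algebra_mul aP m1 m2))).
Qed.

Lemma omega_Phi x v : cotangent_bundle x -> v \in tangent x ->
  omega eta (Phi eta x *m x) v = - (dot (p1 x) (p1 v) + dot (p2 x) (p2 v))
    - 2 * (dot (p1 x) (e2 x) - eta) * (dot (p1 x) (e2 v) + dot (e2 x) (p1 v)).
Proof.
move=> Mx /tangentP[[t1 t2 t3] t4 t5 t6]; have [f1 f2 f3 f4] := Phi_frame eta Mx.
have u3 : dot (e2 x) (e1 v) = - dot (e1 x) (e2 v) by lra.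
have u6 : dot (e1 x) (p2 v) =
  - (dot (p2 x) (e1 v) + dot (e2 x) (p1 v) + dot (p1 x) (e2 v)) by lra.
rewrite /omega e1M e2M p1M p2M f1 f2 f3 f4 !dot_lin.
rewrite !(dotC _ (e1 x)) !(dotC _ (e2 x)) !(dotC _ (p1 x)) !(dotC _ (p2 x)).
by rewrite t1 t2 u3 u6; ring.
Qed.

(* For a1 = a2 = a and a4 = 0, H is a / 2 times the Casimir <Phi, Phi> plus a
   function of the moment <p1, e2> of the right SO(2)-action. *)
Lemma ham_vector_isotropic (a : R) x : cotangent_bundle x ->
  vsval (ham_vector eta (dfun (H_contact a a 0) x)) =
  a *: ((2 * dot (p1 x) (e2 x) - eta) *: spin x + Phi eta x *m x).
Proof.
move=> Mx; have E := cotangent_dots Mx; apply: ham_vector_eq => //.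
  apply: memvZ; apply: memvD; last by apply: rotation_tangent; exact: Phi_skew.
  by apply: memvZ; exact: spin_tangent.
move=> v; rewrite dfunE; have Tv := subvsP v.
move: (vsval v) Tv => {}v Tv; have /tangentP[_ _ _ t6] := Tv.
have u6 : dot (e1 x) (p2 v) =
  - (dot (p2 x) (e1 v) + dot (e2 x) (p1 v) + dot (p1 x) (e2 v)) by lra.
rewrite omegaZl omegaPl omega_spin //.
by rewrite omega_Phi // H_contact_diff (dotC (p2 v)) (dotC (p1 v) (e2 x)) u6 E; field.
Qed.

(** The derivative of [H] along [spin] is (a2 - a1) [<p1, p2>] + a4 ([<p1, p1>] - [<p2, p2>]), the
    detecting function unless a1 = a2 and a4 = 0. In that isotropic case the coefficient of [spin]
    in the Hamiltonian vector is used instead. *)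
Lemma integrable_contact (a1 a2 a4 : R) : (3 <= n)%N -> 0 < a1 ->
  integrability_conclusion eta (@H_contact R n a1 a2 a4).
Proof.
move=> n3 a1_gt0; have aP := @polyfun_algebra R n.
have P1 := funext (@p1E R n); have P2 := funext (@p2E R n).
have E2 := funext (@e2E R n).
have [[ea e4]|neq] := pselect (a2 = a1 /\ a4 = 0).
  rewrite ea e4; apply: (@integrable_of_transverse _
    (fun x => 2 * dot (p1 x) (e2 x) - eta)) => //.
  - exact: polyfun_H_contact.
  - apply: (algebra_sub aP); last exact: (algebra_cst aP).
    exact: (algebra_scale aP _ (polyfun_dotf P1 E2)).
  - by move=> x C; exact: H_contact_invariant.
  - move=> x Mx C0 h0; rewrite ham_vector_isotropic //.
    apply: contraNN (spin_notin_orbit Mx C0).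
    have PO : Phi eta x *m x \in so_orbit x.
      by apply/so_orbitP; exists (Phi eta x) => //; exact: Phi_skew.
    move=> /(memvZ a1^-1); rewrite scalerA mulVf ?gt_eqF // scale1r => SO.
    have := memvB SO PO; rewrite addrK => /(memvZ (2 * dot (p1 x) (e2 x) - eta)^-1).
    by rewrite scalerA mulVf // scale1r.
  (* This m makes 2 m - eta equal to 1. *)
  - move=> d; exists ((eta + 1) / 2), 1, 1; rewrite mulr1 oner_eq0; split=> // y _ -> _ _ _.
    by rewrite (_ : _ - _ = 1) ?oner_eq0 //; field.
apply: (@integrable_of_transverse _ (fun x => (a2 - a1) * dot (p1 x) (p2 x)
    + a4 * (dot (p1 x) (p1 x) - dot (p2 x) (p2 x)))) => //.
- exact: polyfun_H_contact.
- apply: (algebra_add aP); first exact: (algebra_scale aP _ (polyfun_dotf P1 P2)).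
  apply: (algebra_scale aP).
  exact: (algebra_sub aP (polyfun_dotf P1 P1) (polyfun_dotf P2 P2)).
- by move=> x C; exact: H_contact_invariant.
- move=> x Mx _ h0; apply: spin_transverse => //; apply: contraNneq h0 => <-.
  have E := cotangent_dots Mx; have [s1 s2 s3 s4] := spinE x.
  by rewrite H_contact_diff s1 s2 s3 s4 !dot_lin !E; apply/eqP; ring.
move=> d; have [ea|a21] := eqVneq a2 a1.
  have e4 : a4 != 0 by apply/eqP => e4; apply: neq.
  have d0 := sqr_ge0 d.
  (* Here a^2 = (2 + d^2)^2 exceeds 1 + d^2, so the squared norms of p1 and p2 differ. *)
  exists 0, (2 + d ^+ 2), 1; rewrite mulr1; split=> [|y _ _ -> -> _].
    by rewrite gt_eqF //; lra.
  rewrite ea subrr mul0r add0r mulf_neq0 // gt_eqF //.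
  by move: (d ^+ 2) d0 => D d0; nra.
(* With m = 0 and b = 1, the choices a = 1 and a = -1 give the values (a2 - a1) - a4 d^2 and - (a2 -
   a1) - a4 d^2, which cannot both vanish when a1 and a2 differ. *)
have [h|h] := eqVneq (a2 - a1 - a4 * d ^+ 2) 0.
  exists 0, (-1), 1; rewrite mulr1 oppr_eq0 oner_eq0; split=> // y _ _ -> -> ->.
  apply: contra_neq a21 => h'.
  rewrite -sqrrN expr1n in h'; lra.
exists 0, 1, 1; rewrite mulr1 oner_eq0; split=> // y _ _ -> -> ->.
by apply: contra_neq h => <-; ring.
Qed.

(** The derivative of [H] along [spin] is [- a1 <p1, p2>], so [<p1, p2>] itself detects
    transversality. *)
Lemma integrable_D0 (a1 a3 : R) : (3 <= n)%N -> 0 < a1 ->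
  integrability_conclusion eta (@H_D0 R n a1 a3).
Proof.
move=> n3 a1_gt0.
apply: (@integrable_of_transverse _ (fun x => dot (p1 x) (p2 x))) => //.
- exact: polyfun_H_D0.
- exact: (polyfun_dotf (funext (@p1E R n)) (funext (@p2E R n))).
- by move=> x C; exact: H_D0_invariant.
- move=> x Mx C0 _; apply: spin_transverse => //.
  have E := cotangent_dots Mx; have [s1 s2 s3 s4] := spinE x.
  rewrite H_D0_diff s1 s2 s3 s4 !dot_lin !E
    (_ : _ + _ = - a1 * dot (p1 x) (p2 x)); last by ring.
  by rewrite mulf_neq0 // oppr_eq0 gt_eqF.
by move=> d; exists 0, 1, 1; rewrite mulr1 oner_eq0; split=> // y _ _ _ _ ->; rewrite oner_eq0.
Qed.

End Transverse.

Theorem theorem2 (R : realType) (n : nat) (eta : R)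
    (g : config R n -> config R n -> config R n -> R) (H : phase R n -> R)
    (hn : (3 <= n)%N)
    (hsR : (exists a1 a2 a4 : R,
              [/\ 0 < a1, 0 < a2, a4 ^+ 2 < a1 * a2,
                  H = @H_contact R n a1 a2 a4
                & invariant_sR (@contact_distribution R n) g H]) \/
           (4 <= n)%N /\
           (exists a1 a3 : R,
              [/\ 0 < a1, 2 * a3 < a1,
                  H = @H_D0 R n a1 a3
                & invariant_sR (@D0_distribution R n) g H])) :
  let F := generated_algebra (integral_generators eta H) in
  [/\ nc_integrable eta H,
      complete_algebra eta F,
      forall f, F f -> first_integral eta H f,
      (4 <= n)%N -> invariant_tori_dim F 3
    & n = 3%N -> invariant_tori_dim F 2].
Proof.
case: hsR => [[a1 [a2 [a4 [a1_gt0 _ _ -> _]]]]|[_ [a1 [a3 [a1_gt0 _ -> _]]]]].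
  exact: integrable_contact.
exact: integrable_D0.
Qed.
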